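(* (i) For $6\le n\le 9$: $\mathrm{ex}_3(n;\{P,C\}\mid M)=2n-4$. (ii) For $n=10$: $\mathrm{ex}_3(10;\{P,C\}\mid M)=20$. (iii) For $n\ge 11$: $\mathrm{ex}_3(n;\{P,C\}\mid M)=4+\binom{n-4}{2}$ and $\mathrm{Ex}_3(n;\{P,C\}\mid M)=\{\mathrm{Co}(n)\}$.
   Context: All hypergraphs are 3-uniform; containment means containing an isomorphic copy. $P$ is the loose 3-uniform path of length 3: vertices $a,b,c,d,e,f,g$, edges $\{a,b,c\},\{c,d,e\},\{e,f,g\}$. $C$ is the loose triangle: vertices $x_1,x_2,x_3,y_1,y_2,y_3$, edges $\{x_1,y_3,x_2\},\{x_2,y_1,x_3\},\{x_3,y_2,x_1\}$. $M$ is the 3-graph consisting of two disjoint edges. The comet $\mathrm{Co}(n)$ is the $n$-vertex 3-graph with vertex set $\{c,h_1,h_2,h_3\}\cup R$, $|R|=n-4$, whose edges are the four triples of $\{c,h_1,h_2,h_3\}$ together with all triples $\{c,u,v\}$ with $u,v\in R$. Conditional Turán number: $\mathrm{ex}_3(n;\mathcal F\mid\mathcal G)$ is the maximum number of edges of an $n$-vertex 3-graph $H$ that contains no member of $\mathcal F$ and contains some member of $\mathcal G$; $\mathrm{Ex}_3(n;\mathcal F\mid\mathcal G)$ is the family (up to isomorphism) of such $H$ attaining the maximum. *)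

(* Defs.v *)
From mathcomp Require Import all_boot.
Set Implicit Arguments. Unset Strict Implicit. Unset Printing Implicit Defensive.

Definition uniform3 (T : finType) (H : {set {set T}}) : Prop :=
  forall e, e \in H -> #|e| = 3.

Definition contains (T U : finType) (F : {set {set T}}) (H : {set {set U}}) : Prop :=
  exists f : T -> U, injective f /\ forall e, e \in F -> f @: e \in H.

Definition hiso (T : finType) (H1 H2 : {set {set T}}) : Prop :=
  exists f : T -> T, bijective f /\ (fun e : {set T} => f @: e) @: H1 = H2.

Definition tri (k : nat) (a b c : nat) : {set 'I_k.+1} := [set inord a; inord b; inord c].

Definition Ppath : {set {set 'I_7}} := [set tri 6 0 1 2; tri 6 2 3 4; tri 6 4 5 6].
(* Loose triangle: x1,x2,x3,y1,y2,y3 = 0,1,2,3,4,5. *)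
Definition Ctri : {set {set 'I_6}} := [set tri 5 0 5 1; tri 5 1 3 2; tri 5 2 4 0].
Definition Mtwo : {set {set 'I_6}} := [set tri 5 0 1 2; tri 5 3 4 5].

Definition admissible (n : nat) (H : {set {set 'I_n}}) : Prop :=
  uniform3 H /\ ~ contains Ppath H /\ ~ contains Ctri H /\ contains Mtwo H.

Definition ex_is (n m : nat) : Prop :=
  (exists H : {set {set 'I_n}}, admissible H /\ #|H| = m) /\
  (forall H : {set {set 'I_n}}, admissible H -> #|H| <= m).

(* The comet Co(n): c = 0, h1,h2,h3 = 1,2,3, R = {4,...,n-1}. *)
Definition Comet (n : nat) : {set {set 'I_n}} :=
  [set e : {set 'I_n} | (#|e| == 3) &&
     ([forall x in e, val x < 4] ||
      ([exists x in e, val x == 0] && [forall x in e, (val x == 0) || (4 <= val x)]))].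

(* Main.v *)
Require Import Defs.
From mathcomp Require Import all_boot all_algebra.
From mathcomp Require Import zify.

(** An edge family contains neither [P] nor [C] exactly when any two edges that meet an edge [e] in two different single vertices agree off [e].

    Suppose first that such a pair occurs, say [xyz], [xpq] and [ypq] are edges.  The local condition then fixes the type of every edge that leaves the five points: it is disjoint from them, or contains [pq], or contains a pair of [xyz], and the points joined to a pair of [xyz] lie on almost nothing else.

    Otherwise the edges meeting a given edge in one vertex all do so at the same vertex.  If no two edges meet in exactly one vertex, oddtown gives at most [n] edges.  If two edges meet exactly in [c], every edge avoiding [c] contains or misses [e \ c] for each edge [e] meeting another edge in [c] alone.  So, unless there is a core [abz], [abc], [acd], [cde] on six vertices that each further vertex joins in at most one edge, either the edges through [c] form a separate component, or a pair is contained in or missed by every edge, or a triple [A] is met only by the four triples of [c + A].  Deleting these pieces and inducting on the number of vertices gives the bound, and the last case is the comet.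

    The bound [8] on six vertices is obtained by exhaustive search. *)

Set Implicit Arguments. Unset Strict Implicit. Unset Printing Implicit Defensive.

(** * The local condition *)

(** Complete families on at most five vertices have no room for [P] or [C] and are at least as large
    as a star. This is why [fbound] changes form at 6 and why two complete five-point families give
    the exceptional value 20 on ten vertices. Deleting the triple of a comet may destroy every
    matching, so an induction on [gbound] alone does not close: it has to carry [fbound], the bound
    without the matching condition, as well. Equality for a comet on n vertices moreover requires a
    full star on the n - 3 vertices left, so the induction also records that a family attaining
    [fbound] on at least 8 = 11 - 3 vertices is a star. Every configuration other than the comet is
    shown to satisfy [below], whose inequality is strict from 11 vertices on, and so never enters
    the discussion of uniqueness. *)

Ltac neqs := rewrite /= ?inE ?negb_or; repeat match goal with
  | h : is_true (?a != ?b) |- context [?a == ?b] => rewrite (negbTE h)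
  | h : is_true (?a != ?b) |- context [?b == ?a] => rewrite (eq_sym b a) (negbTE h)
  end; rewrite ?eqxx //=.

Section Triples.
Variable T : finType.
Implicit Types (x y z t : T) (e f g V W : {set T}) (H : {set {set T}}).

Lemma card_set3 x y z : uniq [:: x; y; z] -> #|[set x; y; z]| = 3.
Proof.
move=> /= /and3P[]; rewrite !inE negb_or => /andP[xy xz] yz _.
by rewrite -setUA cardsU1 cards2 !inE negb_or xy xz yz.
Qed.

Lemma set3_swap12 x y z : [set y; x; z] = [set x; y; z].
Proof. by rewrite [[set y; x]]setUC. Qed.

Lemma set3_swap23 x y z : [set x; z; y] = [set x; y; z].
Proof. by rewrite -!setUA [[set z; y]]setUC. Qed.

Lemma card3_exists e : #|e| = 3 -> exists x y z, uniq [:: x; y; z] /\ e = [set x; y; z].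
Proof.
move=> e3.
have : size (enum e) = 3 by rewrite -cardE.
have := enum_uniq e; have : enum e =i e by move=> t; rewrite mem_enum.
case: (enum e) => [|x [|y [|z [|]]]] // eE u _.
exists x, y, z; split=> //; apply/setP => t; rewrite -eE !inE; by rewrite orbA.
Qed.

Lemma card3_eq e x y z : #|e| = 3 -> uniq [:: x; y; z] ->
  x \in e -> y \in e -> z \in e -> e = [set x; y; z].
Proof.
move=> e3 u xe ye ze; apply/esym/eqP; rewrite eqEcard e3 card_set3 // andbT.
by apply/subsetP => t; rewrite !inE => /orP[/orP[]|] /eqP ->.
Qed.

Lemma set3_uniq x y z : #|[set x; y; z]| = 3 -> uniq [:: x; y; z].
Proof.
move=> h; apply/card_uniqP => /=; rewrite -h; apply: eq_card => t.
by rewrite !inE orbA.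
Qed.

Definition uniform H := forall e, e \in H -> #|e| = 3.

Definition on H V := forall e, e \in H -> e \subset V.

Definition within H V := [set e in H | e \subset V].

Definition matching H := exists e f, [/\ e \in H, f \in H & e :&: f = set0].

(* Disjoint [f] and [g] would create [P], and [f] and [g] with exactly one common vertex would create [C]. *)
Definition pcfree H := uniform H /\ forall e f g, e \in H -> f \in H -> g \in H ->
  #|e :&: f| = 1 -> #|e :&: g| = 1 -> e :&: f != e :&: g -> f :\: e = g :\: e.

Definition centred H := forall e f g, e \in H -> f \in H -> g \in H ->
  #|e :&: f| = 1 -> #|e :&: g| = 1 -> e :&: f = e :&: g.

Lemma uniform_sub H H' : H' \subset H -> uniform H -> uniform H'.
Proof. by move=> /subsetP s u e /s/u. Qed.

Lemma pcfree_sub H H' : H' \subset H -> pcfree H -> pcfree H'.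
Proof.
move=> s [u h]; split; first exact: uniform_sub u.
by move/subsetP: s => s e f g /s ? /s ? /s ?; apply: h.
Qed.

Lemma centred_sub H H' : H' \subset H -> centred H -> centred H'.
Proof. by move/subsetP => s h e f g /s ? /s ? /s ?; apply: h. Qed.

Lemma within_sub H V : within H V \subset H.
Proof. by apply/subsetP => e; rewrite inE => /andP[]. Qed.

Lemma within_on H V : on (within H V) V.
Proof. by move=> e; rewrite inE => /andP[]. Qed.

Lemma setI3_single x y z f : x \in f -> y \notin f -> z \notin f ->
  [set x; y; z] :&: f = [set x].
Proof.
move=> xf yf zf; apply/setP => t; rewrite !inE.
case: (eqVneq t x) => [->|_]; rewrite ?xf //=.
by case: (eqVneq t y) => [->|_]; rewrite ?(negPf yf) ?andbF //=;
   case: (eqVneq t z) => [->|_]; rewrite ?(negPf zf) ?andbF.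
Qed.

(** Working form of the local condition, vertex by vertex: a single vertex outside [xyz] on which
    [f] and [g] differ is already a contradiction. *)
Lemma pcfree_bits H x y z f g : pcfree H -> [set x; y; z] \in H -> f \in H -> g \in H ->
  x \in f -> y \notin f -> z \notin f -> x \notin g -> y \in g -> z \notin g ->
  forall t, t \notin [set x; y; z] -> (t \in f) = (t \in g).
Proof.
move=> [u h] eH fH gH xf yf zf xg yg zg t te.
have ef := setI3_single xf yf zf; have eg := setI3_single yg xg zg.
rewrite set3_swap12 in eg.
have := h _ _ _ eH fH gH; rewrite ef eg !cards1 => /(_ erefl erefl).
have -> : [set x] != [set y].
  by apply/eqP => /setP/(_ x); rewrite !inE eqxx; case: eqP xf yf => // ->  ->.
by move=> /(_ isT)/setP/(_ t); rewrite !in_setD te.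
Qed.

Lemma centred_bits H x y z f g : centred H -> [set x; y; z] \in H -> f \in H -> g \in H ->
  x \in f -> y \notin f -> z \notin f -> x \notin g -> y \in g -> z \notin g -> False.
Proof.
move=> h eH fH gH xf yf zf xg yg zg.
have ef := setI3_single xf yf zf; have eg := setI3_single yg xg zg.
rewrite set3_swap12 in eg.
have := h _ _ _ eH fH gH; rewrite ef eg !cards1 => /(_ erefl erefl)/setP/(_ x).
by rewrite !inE eqxx; case: eqP xf yf => // ->  ->.
Qed.

Lemma matching_dec H : matching H \/ ~ matching H.
Proof.
case: (boolP [exists e in H, exists f in H, e :&: f == set0]).
  by case/exists_inP => e eH /exists_inP[f fH /eqP ef]; left; exists e, f.
move=> N; right=> -[e [f [eH fH ef]]]; move/exists_inPn: N => /(_ e eH)/exists_inPn/(_ f fH).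
by rewrite ef eqxx.
Qed.

Lemma matching_card H V : uniform H -> on H V -> matching H -> 6 <= #|V|.
Proof.
move=> u o [e [f [eH fH ef]]]; rewrite -[6]/(3 + 3) -{1}(u _ eH) -(u _ fH) -cardsUI ef cards0 addn0.
by apply: subset_leq_card; rewrite subUset !o.
Qed.

(** A violation of centring consists of [e] with [f] and [g] meeting it alone at different vertices
    [x] and [y]. The local condition makes [f] and [g] join [x] and [y] to one common pair [pq]; [z]
    is the remaining vertex of [e]. *)
Lemma centred_or_pair H : pcfree H -> centred H \/
  exists x y z p q, [/\ uniq [:: x; y; z; p; q], [set x; y; z] \in H,
    [set x; p; q] \in H & [set y; p; q] \in H].
Proof.
move=> [u h].
case: (boolP [exists e in H, exists f in H, exists g in H,
   [&& #|e :&: f| == 1, #|e :&: g| == 1 & e :&: f != e :&: g]]); last first.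
  move=> /exists_inPn E; left=> e f g eH fH gH /eqP ef /eqP eg.
  move/exists_inPn: (E e eH) => /(_ f fH)/exists_inPn/(_ g gH).
  by rewrite ef eg /= negbK => /eqP.
case/exists_inP => e eH /exists_inP[f fH] /exists_inP[g gH] /and3P[ef eg n].
have D := h _ _ _ eH fH gH (eqP ef) (eqP eg) n.
case/cards1P: ef => x ef; case/cards1P: eg => y eg.
have c2 : #|f :\: e| = 2.
  by have := cardsID e f; rewrite setIC ef cards1 (u f fH) => -[].
case/eqP/cards2P: c2 => p [q] [pq fe].
have ge : g :\: e = [set p; q] by rewrite -D.
have xy : x != y by apply: contra n => /eqP xy; rewrite ef eg xy.
have xe : x \in e by have := set11 x; rewrite -ef inE => /andP[].
have ye : y \in e by have := set11 y; rewrite -eg inE => /andP[].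
have pe : p \notin e by have := set21 p q; rewrite -fe inE => /andP[].
have qe : q \notin e by have := set22 p q; rewrite -fe inE => /andP[].
have : #|e :\: [set x; y]| = 1.
  rewrite cardsD (u e eH) (setIidPr _) ?cards2 ?xy //.
  by apply/subsetP => t; rewrite !inE => /orP[] /eqP ->.
move/eqP/cards1P => [z ez].
have zz : (z \in e) && (z \notin [set x; y]).
  by have := set11 z; rewrite -ez inE andbC.
case/andP: zz => ze; rewrite !inE negb_or => /andP[zx zy].
have ne a b : a \in e -> b \notin e -> a != b by move=> ae; apply: contraNneq => <-.
have U : uniq [:: x; y; z; p; q].
  by rewrite /= !inE !negb_or xy pq (eq_sym x z) (eq_sym y z) zx zy !ne.
right; exists x, y, z, p, q; split=> //.
- rewrite -(@card3_eq e) ?u //; rewrite /= !inE !negb_or xy (eq_sym x z) zx //.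
  by rewrite eq_sym zy.
- suff <- : f = [set x; p; q] by [].
  by rewrite -(setID f e) (setIC f) ef fe setUA.
- suff <- : g = [set y; p; q] by [].
  by rewrite -(setID g e) (setIC g) eg ge setUA.
Qed.

Lemma card_within_binomial H V : uniform H -> on H V -> #|H| <= 'C(#|V|, 3).
Proof.
move=> u o; rewrite -cards_draws; apply: subset_leq_card; apply/subsetP => e eH.
by rewrite inE o //= (u e eH).
Qed.

Lemma card_bigcup_le (I : finType) (A : {set I}) (F : I -> {set {set T}}) :
  #|\bigcup_(i in A) F i| <= \sum_(i in A) #|F i|.
Proof.
elim/big_rec2: _ => [|i a B _ IH]; first by rewrite cards0.
by apply: leq_trans (leq_card_setU _ _) _; rewrite leq_add2l.
Qed.

End Triples.


(** * The local condition derived from the exclusion of [P] and [C] *)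

Section Containment.
Variable U : finType.
Implicit Types (H : {set {set U}}) (s : seq U).

Lemma nth_inj k s x0 : size s = k.+1 -> uniq s -> injective (fun i : 'I_k.+1 => nth x0 s i).
Proof.
move=> ss us i j /eqP; rewrite nth_uniq ?ss ?ltn_ord // => /eqP; exact: val_inj.
Qed.

Lemma imset_tri k s x0 a b c : a <= k -> b <= k -> c <= k ->
  (fun i : 'I_k.+1 => nth x0 s i) @: tri k a b c = [set nth x0 s a; nth x0 s b; nth x0 s c].
Proof. by move=> ak bk ck; rewrite /tri !imsetU !imset_set1 !inordK. Qed.

Lemma contains_path H a b c d e f g : uniq [:: a; b; c; d; e; f; g] ->
  [set a; b; c] \in H -> [set c; d; e] \in H -> [set e; f; g] \in H -> contains Ppath H.
Proof.
move=> us h1 h2 h3; exists (fun i : 'I_7 => nth a [:: a; b; c; d; e; f; g] i).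
split; first exact: nth_inj.
by move=> t; rewrite !inE => /orP[/orP[]|] /eqP ->; rewrite imset_tri.
Qed.

Lemma contains_triangle H a b c d e f : uniq [:: a; b; c; d; e; f] ->
  [set a; f; b] \in H -> [set b; d; c] \in H -> [set c; e; a] \in H -> contains Ctri H.
Proof.
move=> us h1 h2 h3; exists (fun i : 'I_6 => nth a [:: a; b; c; d; e; f] i).
split; first exact: nth_inj.
by move=> t; rewrite !inE => /orP[/orP[]|] /eqP ->; rewrite imset_tri.
Qed.

Lemma contains_matching H : uniform H -> contains Mtwo H <-> matching H.
Proof.
move=> u; split.
  case=> f [fi h]; exists (f @: tri 5 0 1 2), (f @: tri 5 3 4 5).
  split; try by apply: h; rewrite !inE eqxx ?orbT.
  rewrite -imsetI; last by move=> ? ? _ _; apply: fi.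
  suff -> : tri 5 0 1 2 :&: tri 5 3 4 5 = set0 by rewrite imset0.
  by apply/setP => t; rewrite !inE -!val_eqE /= !inordK //; case: t => [[|[|[|[]]]]].
case=> e [f [eH fH ef]].
have [a [b [c [us E]]]] := card3_exists (u _ eH).
have [a' [b' [c' [us' F]]]] := card3_exists (u _ fH).
have ne x y : x \in e -> y \in f -> x != y.
  by move=> xe; apply: contraTneq => <-; have /setP/(_ x) := ef; rewrite !inE xe /= => ->.
exists (fun i : 'I_6 => nth a [:: a; b; c; a'; b'; c'] i); split.
  apply: nth_inj => //; rewrite -[X in uniq X]/([:: a; b; c] ++ [:: a'; b'; c']) cat_uniq us us' andbT /=.
  by rewrite !inE !negb_or; do ?(apply/andP; split) => //; rewrite eq_sym ne // ?E ?F !inE eqxx ?orbT.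
by move=> t; rewrite !inE => /orP[] /eqP ->; rewrite imset_tri //= -?E -?F.
Qed.

(** Let [f] and [g] leave [e] at [x] and [y]. Disjoint remainders give the path with middle edge
    [e]; remainders with exactly one common vertex give a loose triangle. Only equal remainders
    survive. *)
Lemma pcfree_of_forbidden H : uniform H -> ~ contains Ppath H -> ~ contains Ctri H -> pcfree H.
Proof.
move=> u nP nC; split=> // e f g eH fH gH /eqP/cards1P[x ef] /eqP/cards1P[y eg].
rewrite ef eg => nxy; have xy : x != y by apply: contra nxy => /eqP ->.
have /andP[xe xf] : (x \in e) && (x \in f) by have := set11 x; rewrite -ef inE.
have /andP[ye yg] : (y \in e) && (y \in g) by have := set11 y; rewrite -eg inE.
have one t : t \in e -> t \in f -> t = x.
  by move=> te tf; apply/set1P; rewrite -ef inE te.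
have two t : t \in e -> t \in g -> t = y.
  by move=> te tf; apply/set1P; rewrite -eg inE te.
have yf : y \notin f by apply/negP => /(one y ye)/eqP; rewrite eq_sym (negPf xy).
have xg : x \notin g by apply/negP => /(two x xe)/eqP; rewrite (negPf xy).
have cf : #|f :\: e| = 2 by have := cardsID e f; rewrite setIC ef cards1 (u f fH) => -[].
have cg : #|g :\: e| = 2 by have := cardsID e g; rewrite setIC eg cards1 (u g gH) => -[].
have cz : #|e :\: [set x; y]| = 1.
  rewrite cardsD (u e eH) (setIidPr _) ?cards2 ?xy //.
  by apply/subsetP => t; rewrite !inE => /orP[] /eqP ->.
case/eqP/cards1P: cz => z ez.
have : z \in e :\: [set x; y] by rewrite ez inE.
rewrite !inE negb_or => /andP[/andP[zx zy] ze].
have zf : z \notin f by apply/negP => /(one z ze)/eqP; rewrite (negPf zx).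
have zg : z \notin g by apply/negP => /(two z ze)/eqP; rewrite (negPf zy).
have eE : e = [set x; y; z].
  by apply: card3_eq; rewrite ?u //= !inE !negb_or xy !(eq_sym _ z) zx zy.
case/eqP/cards2P: cf => p [q [pq fE]]; case/eqP/cards2P: cg => r [s [rs gE]].
have [pf pe] : p \in f /\ p \notin e by have := set21 p q; rewrite -fE inE => /andP[].
have [qf qe] : q \in f /\ q \notin e by have := set22 p q; rewrite -fE inE => /andP[].
have [rg re] : r \in g /\ r \notin e by have := set21 r s; rewrite -gE inE => /andP[].
have [sg se] : s \in g /\ s \notin e by have := set22 r s; rewrite -gE inE => /andP[].
have fS : f = [set x; p; q] by rewrite -(setID f e) (setIC f) ef fE setUA.
have gS : g = [set y; r; s] by rewrite -(setID g e) (setIC g) eg gE setUA.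
have ne a : a \notin e -> [/\ a != x, a != y & a != z].
  by move=> ae; split; apply: contraNneq ae => ->.
have [px py pz] := ne p pe; have [qx qy qz] := ne q qe.
have [rx ry rz] := ne r re; have [sx sy sz] := ne s se.
(* [a] is the vertex shared by the remainders, [b] and [c] are the private ones. The corners of the
   triangle are [x], [y], [a], and [z] is the middle vertex of [e]. *)
have tri_case a b c : f = [set x; b; a] -> g = [set y; c; a] ->
   uniq [:: x; y; a; c; b; z] -> contains Ctri H.
  move=> fE' gE' us; apply: (contains_triangle us).
  - by rewrite set3_swap23 -eE.
  - by rewrite -gE'.
  - by rewrite -set3_swap12 -set3_swap23 -set3_swap12 -fE'.
rewrite fE gE; apply/eqP; apply/negPn/negP => ns.
case: (boolP ((p == r) || (p == s) || (q == r) || (q == s))) => [|]; last first.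
  rewrite !negb_or => /andP[/andP[/andP[pr ps] qr] qs]; apply: nP.
  apply: (@contains_path H p q x z y r s).
  - by neqs.
  - by rewrite -set3_swap23 set3_swap12 -fS.
  - by rewrite set3_swap23 -eE.
  - by rewrite -gS.
move=> C; apply: nC.
have fS' : f = [set x; q; p] by rewrite fS set3_swap23.
have gS' : g = [set y; s; r] by rewrite gS set3_swap23.
case/orP: C => [/orP[/orP[]|]|] /eqP C; move: ns; rewrite C => ns.
- subst r; apply: (tri_case p q s) => //; have qs : q != s by apply: contra ns => /eqP ->.
  by neqs.
- subst s; have qr : q != r by apply: contra ns => /eqP ->; rewrite setUC.
  by apply: (tri_case p q r) => //; neqs.
- subst r; have ps : p != s by apply: contra ns => /eqP ->; rewrite setUC.
  by apply: (tri_case q p s) => //; neqs.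
- subst s; have pr : p != r by apply: contra ns => /eqP ->.
  by apply: (tri_case q p r) => //; neqs.
Qed.

End Containment.

(** * Six vertices *)

Definition common (a b : seq nat) := [seq i <- a | i \in b].

(** The loose triangle; it is the only configuration to test on six vertices, since [P] needs
    seven. *)
Definition loose (a b c : seq nat) :=
  [&& size (common a b) == 1, size (common a c) == 1, size (common b c) == 1
    & ~~ has (fun i => (i \in b) && (i \in c)) a].

(* Branch and bound: [chosen] are the triples already taken, [rest] the undecided ones. Conditionals instead of [&&] and [||], which would evaluate both branches under call by value. *)
Fixpoint bounded m (forced chosen rest : seq (seq nat)) :=
  if size chosen + size rest <= m then true else
  if rest is t :: r then
    if (if has (fun a => has (fun b => loose t a b) chosen) chosen then true
        else bounded m forced (t :: chosen) r)
    then if t \in forced then true else bounded m forced chosen r else false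
  else false.

(** [h] stands for the unknown family and [chosen] stays inside it. Taking [t] need not be explored
    when [t] closes a loose triangle with two chosen triples, and rejecting [t] need not be explored
    when [t] is forced. *)
Lemma boundedP m (h : pred (seq nat)) forced chosen rest :
  (forall a b c, h a -> h b -> h c -> ~~ loose a b c) -> all h forced -> all h chosen ->
  bounded m forced chosen rest -> size chosen + count h rest <= m.
Proof.
move=> nl hf; elim: rest chosen => [|t r IH] chosen hc /=.
  by case: ifP.
case: ifP => [|_].
  by move=> + _; apply: leq_trans; rewrite leq_add2l -[(size r).+1]/(size (t :: r)) (count_size h (t :: r)).
case: ifP => // A B.
case ht: (h t).
  rewrite addnA addn1 -[(size chosen).+1]/(size (t :: chosen)); apply: IH; first by rewrite /= ht.
  case: ifP A => // /hasP[a ac /hasP[b bc]].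
  by rewrite (negPf (nl _ _ _ _ _ _)) // (allP hc).
apply: IH => //; case: ifP B => // tf.
by move: (allP hf t tf); rewrite ht.
Qed.

Definition triples6 : seq (seq nat) :=
  [seq t <- [seq [:: x.1; x.2.1; x.2.2] | x <- allpairs pair (iota 0 6) (allpairs pair (iota 0 6) (iota 0 6))]
     | sorted ltn t].

(** Forced triples are decided before all others, so that every branch starts from the whole forced
    configuration and is cut early. *)
Definition forced_first forced := forced ++ [seq t <- triples6 | ~~ has (perm_eq t) forced].

Definition triple6 t := [&& size t == 3, uniq t & all (fun i => i < 6) t].

Definition covering order := all (fun i => all (fun j => all (fun k =>
  uniq [:: i; j; k] ==> has (perm_eq [:: i; j; k]) order) (iota 0 6)) (iota 0 6)) (iota 0 6).

Definition at_most_eight forced :=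
  [&& all triple6 (forced_first forced), covering (forced_first forced)
    & bounded 8 forced [::] (forced_first forced)].

Lemma eight_disjoint : at_most_eight [:: [:: 0; 1; 2]; [:: 3; 4; 5]].
Proof. by vm_compute. Qed.

(** The indices 0 to 5 stand for [x], [y], [z], [p], [q], [w]. The first three triples are the
    repeated-pair configuration, the fourth joins the sixth vertex [w] to the pair named in the
    lemma. *)
Lemma eight_xy : at_most_eight [:: [:: 0; 1; 2]; [:: 0; 3; 4]; [:: 1; 3; 4]; [:: 0; 1; 5]].
Proof. by vm_compute. Qed.

Lemma eight_xz : at_most_eight [:: [:: 0; 1; 2]; [:: 0; 3; 4]; [:: 1; 3; 4]; [:: 0; 2; 5]].
Proof. by vm_compute. Qed.

Lemma eight_yz : at_most_eight [:: [:: 0; 1; 2]; [:: 0; 3; 4]; [:: 1; 3; 4]; [:: 1; 2; 5]].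
Proof. by vm_compute. Qed.

Lemma eight_pq : at_most_eight [:: [:: 0; 1; 2]; [:: 0; 3; 4]; [:: 1; 3; 4]; [:: 3; 4; 5]].
Proof. by vm_compute. Qed.

(** * Transfer of the search to six points of an arbitrary type *)

Section SixPoints.
Variables (T : finType) (x0 : T) (s : seq T).
Hypotheses (us : uniq s) (ss : size s = 6).
Implicit Types (H : {set {set T}}).

Definition triple_set (t : seq nat) : {set T} := [set x in map (nth x0 s) t].

Lemma triple_setI a b : all (fun i => i < 6) a -> all (fun i => i < 6) b ->
  triple_set a :&: triple_set b = triple_set (common a b).
Proof.
move=> ha hb; apply/setP => x; rewrite !inE; apply/andP/mapP.
  case=> /mapP[i ia ->] /mapP[j jb] E; exists i => //; rewrite mem_filter ia andbT.
  suff -> : i = j by [].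
  by move/eqP: E; rewrite nth_uniq ?ss ?(allP ha i ia) ?(allP hb j jb) // => /eqP.
by case=> i; rewrite mem_filter => /andP[ib ia] ->; split; apply: map_f.
Qed.

Lemma triple_set1 i : triple_set [:: i] = [set nth x0 s i].
Proof. by apply/setP => x; rewrite !inE. Qed.

(** In a loose triangle the local condition at [a] makes the two vertices of [b] off [a] belong to
    [c] as well, but [b] and [c] share only one vertex. *)
Lemma pcfree_not_loose H a b c : pcfree H -> all triple6 [:: a; b; c] ->
  triple_set a \in H -> triple_set b \in H -> triple_set c \in H -> ~~ loose a b c.
Proof.
move=> [u h] /= /and4P[/and3P[_ _ a6] /and3P[_ _ b6] /and3P[_ _ c6] _] aH bH cH.
apply/negP => /and4P[].
case ab: (common a b) => [|i []] // _; case ac: (common a c) => [|j []] // _.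
case bc: (common b c) => [|k []] // _ nc.
have eb := triple_setI a6 b6; have ec := triple_setI a6 c6; have fg := triple_setI b6 c6.
rewrite ab ac bc !triple_set1 in eb ec fg.
have [ia ib] : i \in a /\ i \in b.
  by have := mem_head i [::]; rewrite -ab mem_filter => /andP[].
have [ja jc] : j \in a /\ j \in c.
  by have := mem_head j [::]; rewrite -ac mem_filter => /andP[].
have ij : i != j by apply: contraNneq nc => E; apply/hasP; exists i; rewrite // ib E jc.
have nij : nth x0 s i != nth x0 s j by rewrite nth_uniq ?ss ?(allP a6 i ia) ?(allP a6 j ja).
have := h _ _ _ aH bH cH; rewrite eb ec !cards1 => /(_ erefl erefl).
have -> : [set nth x0 s i] != [set nth x0 s j].
  by apply/eqP => /set1_inj/eqP; rewrite (negPf nij).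
move=> /(_ isT) E.
have : #|triple_set b :\: triple_set a| = 2.
  by have := cardsID (triple_set a) (triple_set b); rewrite setIC eb cards1 (u _ bH) => -[].
have : triple_set b :\: triple_set a \subset triple_set b :&: triple_set c.
  by rewrite subsetI subsetDl E subsetDl.
by move/subset_leq_card => + e2; rewrite fg cards1 e2.
Qed.

Lemma at_most_eightP H forced : pcfree H -> at_most_eight forced ->
  all (fun t => triple_set t \in H) forced -> #|within H [set x in s]| <= 8.
Proof.
move=> pc /and3P[ok cov bd] hf; set order := forced_first forced in ok cov bd.
have B : 0 + count (fun t => triple6 t && (triple_set t \in H)) order <= 8.
  apply: (boundedP _ _ _ bd) => //.
    move=> a b c /andP[a6 aH] /andP[b6 bH] /andP[c6 cH].
    by apply: (pcfree_not_loose pc); rewrite //= a6 b6 c6.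
  apply/allP => t tf; rewrite (allP hf) // (allP ok) //.
  by rewrite mem_cat tf.
(* The edges are bounded by the length of a list that covers them, so the passage from index triples
   to sets need not be injective. *)
apply: leq_trans B; rewrite add0n -size_filter -(size_map triple_set).
apply: leq_trans (card_size _); apply: subset_leq_card; apply/subsetP => e.
rewrite inE => /andP[eH /subsetP es].
have [x [y [z [u E]]]] := card3_exists (pc.1 e eH).
have ix v : v \in e -> exists2 i, i < 6 & v = nth x0 s i.
  by move/es; rewrite inE => /(nthP x0)[i]; rewrite ss => i6 <-; exists i.
have [i i6 xi] := ix x ltac:(by rewrite E !inE eqxx).
have [j j6 yj] := ix y ltac:(by rewrite E !inE eqxx orbT).
have [k k6 zk] := ix z ltac:(by rewrite E !inE eqxx orbT).
have uijk : uniq [:: i; j; k].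
  by apply: (@map_uniq _ _ (nth x0 s)); rewrite /= -xi -yj -zk.
have I6 l : l < 6 -> l \in iota 0 6 by rewrite mem_iota.
have := allP (allP (allP cov i (I6 _ i6)) j (I6 _ j6)) k (I6 _ k6).
move/implyP/(_ uijk)/hasP => [t to pt].
have eE : e = triple_set t.
  rewrite E; apply/setP => v; rewrite !inE -(perm_mem (perm_map (nth x0 s) pt)) /=.
  by rewrite !inE -xi -yj -zk orbA.
by apply/mapP; exists t; rewrite // mem_filter to (allP ok) //= -eE eH.
Qed.

End SixPoints.

Section SixPointCases.
Variable T : finType.
Implicit Types (H : {set {set T}}).

Let set3E (x y z : T) : [set u in [:: x; y; z]] = [set x; y; z].
Proof. by apply/setP => u; rewrite !inE orbA. Qed.

Lemma card_six_disjoint H a b c d e f : pcfree H -> uniq [:: a; b; c; d; e; f] ->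
  [set a; b; c] \in H -> [set d; e; f] \in H -> #|within H [set x in [:: a; b; c; d; e; f]]| <= 8.
Proof.
move=> pc us h1 h2.
apply: (at_most_eightP (x0 := a) us erefl pc eight_disjoint).
by rewrite /= /triple_set /= !set3E h1 h2.
Qed.

Lemma card_six_pair H x y z p q w : pcfree H -> uniq [:: x; y; z; p; q; w] ->
  [set x; y; z] \in H -> [set x; p; q] \in H -> [set y; p; q] \in H ->
  [|| [set x; y; w] \in H, [set x; z; w] \in H, [set y; z; w] \in H | [set p; q; w] \in H] ->
  #|within H [set v in [:: x; y; z; p; q; w]]| <= 8.
Proof.
move=> pc us h1 h2 h3.
have A t : at_most_eight [:: [:: 0; 1; 2]; [:: 0; 3; 4]; [:: 1; 3; 4]; t] ->
    triple_set x [:: x; y; z; p; q; w] t \in H ->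
    #|within H [set v in [:: x; y; z; p; q; w]]| <= 8.
  move=> C tH; apply: (at_most_eightP (x0 := x) us erefl pc C).
  by rewrite /= tH /triple_set /= !set3E h1 h2 h3.
have S a b c : triple_set x [:: x; y; z; p; q; w] [:: a; b; c] =
   [set nth x [:: x; y; z; p; q; w] a; nth x [:: x; y; z; p; q; w] b; nth x [:: x; y; z; p; q; w] c].
  exact: set3E.
by case/or4P => h; [apply: (A _ eight_xy) | apply: (A _ eight_xz)
  | apply: (A _ eight_yz) | apply: (A _ eight_pq)]; rewrite S.
Qed.

End SixPointCases.

(** * Families without one-point intersections *)

Section Oddtown.
Variable T : finType.
Implicit Types (V : {set T}) (H : {set {set T}}).

Import GRing.Theory.
Local Open Scope ring_scope.

(* Oddtown: the incidence vectors over F_2 are orthonormal, hence independent. *)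
Lemma oddtown H V : uniform H -> on H V ->
  (forall e f, e \in H -> f \in H -> #|e :&: f| <> 1%N) -> (#|H| <= #|V|)%N.
Proof.
move=> u o no.
pose A : 'M['F_2]_(#|H|, #|V|) :=
  \matrix_(i, j) ((enum_val j : T) \in (enum_val i : {set T}))%:R.
have AA : A *m A^T = 1%:M.
  apply/matrixP => i k; rewrite !mxE.
  have ei := enum_valP i; have ek := enum_valP k.
  transitivity (\sum_(j < #|V|) ((enum_val j \in enum_val i) && (enum_val j \in enum_val k))%:R : 'F_2).
    apply: eq_bigr => j _; rewrite !mxE.
    by case: (_ \in _); case: (_ \in _); rewrite ?mulr0 ?mulr1 ?mul0r.
  transitivity ((#|enum_val i :&: enum_val k|)%:R : 'F_2).
    rewrite -[in RHS]sum1_card natr_sum -(big_enum_val (fun x => ((x \in enum_val i) && (x \in enum_val k))%:R)).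
    rewrite [RHS]big_mkcond [LHS]big_mkcond /=; apply: eq_bigr => x _; rewrite inE.
    case xi: (x \in enum_val i) => /=; last by case: ifP.
    rewrite (subsetP (o _ ei) x xi); case: (x \in enum_val k) => /=; last exact: mulr0n.
    exact: mulr1n.
  case: (eqVneq i k) => [->|ik]; first by rewrite setIid (u _ ek); apply/eqP.
  have : (enum_val i != enum_val k) by apply: contra ik => /eqP/enum_val_inj ->.
  move=> nik; have n1 := no _ _ ei ek.
  (* Distinct triples share at most two vertices and one is excluded, so the size is 0 or 2 and
     vanishes in F_2. *)
  have : (#|enum_val i :&: enum_val k| < 3)%N.
    rewrite -(u _ ei) proper_card // properE subsetIl /= subsetI subxx /=.
    apply: contra nik => s; rewrite eqEcard s (u _ ei) (u _ ek) //.
  case: #|_| n1 => [_ _|[n1|[_ _|]]] //; apply/eqP => //.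
rewrite -[X in (X <= _)%N](mxrank1 'F_2) -AA.
exact: leq_trans (mxrankM_maxl _ _) (rank_leq_col _).
Qed.

End Oddtown.

(** * Numerical bounds and counting *)

(* [fbound] bounds all {P,C}-free families on [n] vertices, [gbound] those with two disjoint edges. *)
Definition fbound n := if n < 6 then 'C(n, 3) else 'C(n.-1, 2).

Definition gbound n := if n < 10 then 2 * n - 4 else if n == 10 then 20 else 4 + 'C(n - 4, 2).

Definition below n m := m <= gbound n /\ (11 <= n -> m < gbound n).

Lemma double_bin2 n : 2 * 'C(n, 2) = n * n.-1.
Proof. by rewrite bin2 mul2n even_halfK //; case: n => //= n; rewrite oddM /= andNb. Qed.

Lemma fbound_large n : 6 <= n -> 2 * fbound n = n.-1 * n.-2.
Proof. by move=> h; rewrite /fbound ltnNge h double_bin2. Qed.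

Lemma gbound_large n : 11 <= n -> 2 * gbound n = 8 + (n - 4) * (n - 5).
Proof.
rewrite /gbound => h; have -> : n < 10 = false by lia.
have -> : n == 10 = false by lia.
by rewrite mulnDr double_bin2; congr (_ + _ * _); lia.
Qed.

Lemma fbound_small n : n < 6 -> fbound n <= 2 * n.
Proof. by case: n => [|[|[|[|[|[|]]]]]]. Qed.

(** Eight edges inside a six-point core, two crossing edges at each of [z] outer vertices, one at
    each of the other [t], and the best family on those [t]. *)
Lemma below_six_core z t : below (6 + z + t) (8 + 2 * z + t + fbound t).
Proof.
case: (ltnP (6 + z + t) 11) => h.
  split; last lia.
  by case: t h => [|[|[|[|[|t]]]]]; case: z => [|[|[|[|[|z]]]]] //; lia.
suff h' : 8 + 2 * z + t + fbound t < gbound (6 + z + t) by split; [exact: ltnW | ].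
have := gbound_large h; have -> : 6 + z + t - 4 = (z + t).+2 by lia.
have -> : 6 + z + t - 5 = (z + t).+1 by lia.
case: (ltnP t 6) => t6.
  have := fbound_small t6; set F := fbound t; set G := gbound _; nia.
have := fbound_large t6; set F := fbound t; set G := gbound _; nia.
Qed.

(** Four edges on five points, one crossing edge at each of the [m] outer vertices, and the best
    family on these. *)
Lemma below_five_core m : 3 <= m -> below (m + 5) (4 + m + fbound m).
Proof.
move=> m3; case: (ltnP (m + 5) 11) => h.
  split; last lia.
  by case: m m3 h => [|[|[|[|[|[|m]]]]]] //; lia.
suff h' : 4 + m + fbound m < gbound (m + 5) by split; [exact: ltnW | ].
have m6 : 6 <= m by lia.
have := gbound_large h; have := fbound_large m6; set F := fbound m; set G := gbound _; nia.
Qed.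

(** Five points carrying up to ten edges and separated from the rest. Equality at [m = 5] is the
    exceptional value 20 on ten vertices. *)
Lemma below_complete_five m : 3 <= m -> below (m + 5) (10 + fbound m).
Proof.
move=> m3; case: (ltnP (m + 5) 11) => h.
  split; last lia.
  by case: m m3 h => [|[|[|[|[|[|m]]]]]] //; lia.
suff h' : 10 + fbound m < gbound (m + 5) by split; [exact: ltnW | ].
have m6 : 6 <= m by lia.
have := gbound_large h; have := fbound_large m6; set F := fbound m; set G := gbound _; nia.
Qed.

Lemma below_le n m m' : m' <= m -> below n m -> below n m'.
Proof. by move=> le [h1 h2]; split; [exact: leq_trans h1 | move=> /h2; apply: leq_ltn_trans]. Qed.

Ltac tri := first [assumption | by rewrite set3_swap12 | by rewrite set3_swap23
  | by rewrite set3_swap12 set3_swap23 | by rewrite set3_swap23 set3_swap12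
  | by rewrite set3_swap12 set3_swap23 set3_swap12].

Section Counting.
Variable T : finType.
Implicit Types (x y z p q w : T) (f Q V Z : {set T}) (H : {set {set T}}).

Definition crossing H Q w := [set f in H | (w \in f) && ~~ [disjoint f & Q]].

(** An edge that meets [Q] without lying in it is counted once at each of its vertices outside [Q];
    the overcount is harmless. *)
Lemma card_split H V Q : on H V -> 
  #|H| <= #|within H Q| + \sum_(w in V :\: Q) #|crossing H Q w| + #|within H (V :\: Q)|.
Proof.
move=> o; apply: leq_trans (_ : #|within H Q :|: \bigcup_(w in V :\: Q) crossing H Q w
   :|: within H (V :\: Q)| <= _).
  apply: subset_leq_card; apply/subsetP => f fH; rewrite !inE fH /=.
  case: (boolP (f \subset Q)) => //= /subsetPn[w wf wQ].
  case: (boolP [disjoint f & Q]) => d.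
    by rewrite subsetD o // d orbT.
  apply/orP; left; apply/bigcupP; exists w; rewrite !inE ?fH ?wf //.
  by rewrite wQ (subsetP (o _ fH)).
apply: leq_trans (leq_card_setU _ _) _; rewrite leq_add2r.
apply: leq_trans (leq_card_setU _ _) _; rewrite leq_add2l.
exact: card_bigcup_le.
Qed.

(** [Z] collects the outer vertices allowed two crossing edges. The price is paid back because edges
    missing [Q] also miss [Z], so the remainder lives on fewer vertices. *)
Lemma card_split_le H V Q Z (b : nat) : on H V -> Z \subset V :\: Q ->
  (forall w, w \in V :\: Q -> #|crossing H Q w| <= 1 + (w \in Z)) ->
  (forall f, f \in within H (V :\: Q) -> [disjoint f & Z]) ->
  #|within H Q| <= b ->
  #|H| <= b + 2 * #|Z| + #|V :\: Q :\: Z| + #|within H (V :\: Q :\: Z)|.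
Proof.
move=> o zs hc hz hb; apply: leq_trans (card_split Q o) _.
have -> : within H (V :\: Q) = within H (V :\: Q :\: Z).
  apply/setP => f; rewrite !inE; case fH: (f \in H) => //=.
  rewrite (subsetD _ _ Z); case fs: (f \subset _) => //=.
  by rewrite hz // inE fH.
rewrite leq_add2r -addnA; apply: leq_add => //.
have S : \sum_(w in V :\: Q) #|crossing H Q w| <= \sum_(w in V :\: Q) (1 + (w \in Z)).
  exact: leq_sum.
apply: leq_trans S _.
rewrite big_split /= sum1_card.
have -> : \sum_(w in V :\: Q) nat_of_bool (w \in Z) = #|Z|.
  rewrite -sum1_card [LHS]big_mkcond [RHS]big_mkcond; apply: eq_bigr => w _.
  by case wZ: (w \in Z); [rewrite (subsetP zs) | case: ifP].
have := cardsID Z (V :\: Q); rewrite (setIidPr zs) => <-.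
by rewrite mul2n -addnn; lia.
Qed.

End Counting.

(** * Families with a repeated pair *)

Section PairCase.
Variable T : finType.
Implicit Types (t w : T) (f g : {set T}).
Variables (H : {set {set T}}) (x y z p q : T).
Hypotheses (pc : pcfree H) (us : uniq [:: x; y; z; p; q]).
Hypotheses (xyz : [set x; y; z] \in H) (xpq : [set x; p; q] \in H) (ypq : [set y; p; q] \in H).

Let U := [set t in [:: x; y; z; p; q]].

Let neqs5 : [/\ [/\ x != y, x != z, x != p & x != q], [/\ y != z, y != p & y != q],
   z != p, z != q & p != q].
Proof. by move: us; rewrite /= !inE !negb_or -!andbA => /and5P[-> -> -> -> /and5P[-> -> -> -> /and3P[-> ->]]]. Qed.

Lemma subset_of_three f a b c : f \in H -> a \in f -> b \in f -> c \in f ->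
  uniq [:: a; b; c] -> a \in U -> b \in U -> c \in U -> f \subset U.
Proof.
move=> fH af bf cf u aU bU cU; rewrite (card3_eq (pc.1 f fH) u af bf cf).
by apply/subsetP => t; rewrite in_setU in_set2 in_set1 => /orP[/orP[]|] /eqP ->.
Qed.

(** Three vertices in [U] would put [f] inside [U]. Meeting [xyz] in one vertex forces [p] and [q]
    into [f], by comparison with [ypq] or [xpq], hence three vertices again. Meeting [U] in just one
    of [p], [q] contradicts the local condition at [xpq], by comparison with [xyz]. The remaining
    membership patterns are enumerated. *)
Lemma pair_edge_type f : f \in H -> ~~ (f \subset U) -> ~~ [disjoint f & U] ->
  [&& p \in f, q \in f, x \notin f, y \notin f & z \notin f] ||
  [&& p \notin f, q \notin f & (x \in f) + (y \in f) + (z \in f) == 2].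
Proof.
have [[xy xz xp xq] [yz yp yq] zp zq pq] := neqs5.
move=> fH nU nd.
have three a b c : a \in f -> b \in f -> c \in f -> uniq [:: a; b; c] ->
    a \in U -> b \in U -> c \in U -> False.
  by move=> *; move: nU; rewrite (@subset_of_three f a b c).
have Fx : ~ [/\ x \in f, y \notin f & z \notin f].
  case=> xf yf zf; have A := pcfree_bits pc xyz fH ypq xf yf zf.
  have Ap := A _ _ _ p; have Aq := A _ _ _ q; move: Ap Aq; rewrite !inE; neqs => Ap Aq.
  by apply: (three x p q); rewrite ?Ap ?Aq ?inE //; neqs.
have Fy : ~ [/\ x \notin f, y \in f & z \notin f].
  case=> xf yf zf; have A := pcfree_bits pc xyz xpq fH.
  have Ap := A _ _ _ xf yf zf p; have Aq := A _ _ _ xf yf zf q; move: Ap Aq; rewrite !inE; neqs => Ap Aq.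
  by apply: (three y p q); rewrite -?Ap -?Aq ?inE //; neqs.
have Fz : ~ [/\ x \notin f, y \notin f & z \in f].
  case=> xf yf zf; have E : [set x; z; y] \in H by tri.
  have A := pcfree_bits pc E xpq fH.
  have Ap := A _ _ _ xf zf yf p; have Aq := A _ _ _ xf zf yf q; move: Ap Aq; rewrite !inE; neqs => Ap Aq.
  by apply: (three z p q); rewrite -?Ap -?Aq ?inE //; neqs.
have F0 a b : [set x; a; b] \in H -> uniq [:: x; y; z; a; b] ->
    ~ [/\ x \notin f, y \notin f, z \notin f, a \in f & b \notin f].
  rewrite /= !inE !negb_or => E /and5P[/and4P[_ _ xa xb] /and3P[_ ya yb] /andP[za zb] ab _].
  move=> [xf yf zf af bf].
  have A := pcfree_bits pc E xyz fH.
  have {}A : (y \in [set x; y; z]) = (y \in f) by apply: A; rewrite ?inE //; neqs.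
  by move: A; rewrite (negPf yf) !inE eqxx orbT.
have E' : [set x; q; p] \in H by tri.
have Fp := F0 p q xpq us; have Fq := F0 q p E' ltac:(by neqs).
have three' a b c : uniq [:: a; b; c] -> [&& a \in U, b \in U & c \in U] ->
    ~~ [&& a \in f, b \in f & c \in f].
  by move=> u /and3P[aU bU cU]; apply/and3P => -[? ? ?]; apply: (three a b c).
have [xU yU zU pU qU] : [/\ x \in U, y \in U, z \in U, p \in U & q \in U].
  by rewrite !inE; split; neqs; rewrite ?orbT.
have T1 : ~~ [&& x \in f, y \in f & z \in f] by apply: three'; rewrite ?xU ?yU ?zU ?pU ?qU //; neqs.
have T2 : ~~ [&& x \in f, y \in f & p \in f] by apply: three'; rewrite ?xU ?yU ?zU ?pU ?qU //; neqs.
have T3 : ~~ [&& x \in f, y \in f & q \in f] by apply: three'; rewrite ?xU ?yU ?zU ?pU ?qU //; neqs.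
have T4 : ~~ [&& x \in f, z \in f & p \in f] by apply: three'; rewrite ?xU ?yU ?zU ?pU ?qU //; neqs.
have T5 : ~~ [&& x \in f, z \in f & q \in f] by apply: three'; rewrite ?xU ?yU ?zU ?pU ?qU //; neqs.
have T6 : ~~ [&& y \in f, z \in f & p \in f] by apply: three'; rewrite ?xU ?yU ?zU ?pU ?qU //; neqs.
have T7 : ~~ [&& y \in f, z \in f & q \in f] by apply: three'; rewrite ?xU ?yU ?zU ?pU ?qU //; neqs.
have ND : [|| x \in f, y \in f, z \in f, p \in f | q \in f].
  move: nd; rewrite disjoint_sym disjoint_subset => /subsetPn[t]; rewrite !inE negbK => tU tf.
  by case/or4P: tU => [/eqP <-|/eqP <-|/eqP <-|/orP[]/eqP <-]; rewrite tf ?orbT.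
move/and3P: Fx; move/and3P: Fy; move/and3P: Fz; move/and5P: Fp; move/and5P: Fq.
move: ND T1 T2 T3 T4 T5 T6 T7.
by do 5![case: (_ \in f)].
Qed.


Definition pair_edge w := [|| [set x; y; w] \in H, [set x; z; w] \in H | [set y; z; w] \in H].

Lemma notin_U w : w \notin U -> [/\ w != x, w != y, w != z, w != p & w != q].
Proof. by rewrite !inE !negb_or => /and5P[]. Qed.

Lemma disjoint_U f : [disjoint f & U] -> [/\ x \notin f, y \notin f, z \notin f, p \notin f & q \notin f].
Proof.
rewrite disjoint_sym disjoint_subset => /subsetP h.
by split; apply: h; rewrite !inE eqxx ?orbT.
Qed.

(** An edge at [w] missing [U] would disagree at [p] with [xpq] or [ypq], the local condition being
    taken at the edge joining [w] to a pair of [xyz]. *)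
Lemma pair_edge_outside w g : w \notin U -> pair_edge w -> g \in H -> w \in g -> ~~ [disjoint g & U].
Proof.
have [[xy xz xp xq] [yz yp yq] zp zq pq] := neqs5.
move=> /notin_U[wx wy wz wp wq] aw gH wg; apply/negP => /disjoint_U[xg yg zg pg qg].
case/or3P: aw => aw.
- have E : [set w; x; y] \in H by tri.
  have A : (p \in g) = (p \in [set x; p; q]).
    by apply: (pcfree_bits pc E); rewrite ?inE //; neqs.
  by move: A; rewrite (negPf pg) !inE eqxx orbT.
- have E : [set w; x; z] \in H by tri.
  have A : (p \in g) = (p \in [set x; p; q]).
    by apply: (pcfree_bits pc E); rewrite ?inE //; neqs.
  by move: A; rewrite (negPf pg) !inE eqxx orbT.
- have E : [set w; y; z] \in H by tri.
  have A : (p \in g) = (p \in [set y; p; q]).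
    by apply: (pcfree_bits pc E); rewrite ?inE //; neqs.
  by move: A; rewrite (negPf pg) !inE eqxx orbT.
Qed.

(** Outer vertices joined to different pairs of [xyz] violate the local condition, so all of them
    use the pair used by [w]; [g0 w'] is that pair together with [w']. *)
Lemma pair_edge_unique w : w \notin U -> pair_edge w -> exists g0 : T -> {set T},
  forall f w', f \in H -> w' \in f -> w' \notin U -> w' != w ->
   (x \in f) + (y \in f) + (z \in f) = 2 -> f = g0 w'.
Proof.
have [[xy xz xp xq] [yz yp yq] zp zq pq] := neqs5.
move=> /notin_U[wx wy wz wp wq] aw.
have two f w' : f \in H -> w' \in f -> w' \notin U -> w' != w ->
   (x \in f) + (y \in f) + (z \in f) = 2 ->
   [\/ f = [set x; y; w'], f = [set x; z; w'] | f = [set y; z; w']] /\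
   (w \notin f).
  move=> fH wf /notin_U[wx' wy' wz' wp' wq'] ww.
  have c3 a b : a \in f -> b \in f -> a != b -> w' != a -> w' != b -> a != w -> b != w ->
     f = [set a; b; w'] /\ w \notin f.
    move=> af bf ab wa wb aw' bw'; have E : f = [set a; b; w'].
      by apply: (card3_eq (pc.1 f fH)) => //; neqs.
    by split=> //; rewrite E !inE; neqs.
  case xf: (x \in f); case yf: (y \in f); case zf: (z \in f) => // _.
  - have [-> ?] := c3 x y xf yf xy wx' wy' ltac:(by rewrite eq_sym) ltac:(by rewrite eq_sym).
    by split=> //; constructor.
  - have [-> ?] := c3 x z xf zf xz wx' wz' ltac:(by rewrite eq_sym) ltac:(by rewrite eq_sym).
    by split=> //; constructor.
  - have [-> ?] := c3 y z yf zf yz wy' wz' ltac:(by rewrite eq_sym) ltac:(by rewrite eq_sym).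
    by split=> //; constructor.
case/or3P: aw => aw.
- exists (fun w' => [set x; y; w']) => f w' fH wf wU ww c.
  have [wx' wy' wz' wp' wq'] := notin_U wU.
  have [fE wf'] := two f w' fH wf wU ww c; case: fE => // fE.
  + have A : (z \in f) = (z \in [set y; p; q]).
      by apply: (pcfree_bits pc aw); rewrite // ?fE ?inE //; neqs.
    by move: A; rewrite fE !inE; neqs.
  + have E : [set y; x; w] \in H by tri.
    have A : (z \in f) = (z \in [set x; p; q]).
      by apply: (pcfree_bits pc E); rewrite // ?fE ?inE //; neqs.
    by move: A; rewrite fE !inE; neqs.
- exists (fun w' => [set x; z; w']) => f w' fH wf wU ww c.
  have [wx' wy' wz' wp' wq'] := notin_U wU.
  have [fE wf'] := two f w' fH wf wU ww c; case: fE => // fE.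
  + have E : [set x; y; w'] \in H by rewrite -fE.
    have A : (z \in [set x; z; w]) = (z \in [set y; p; q]).
      by apply: (pcfree_bits pc E); rewrite // ?fE ?inE //; neqs.
    by move: A; rewrite !inE; neqs.
  + have E : [set z; x; w] \in H by tri.
    have A : (y \in f) = (y \in [set x; p; q]).
      by apply: (pcfree_bits pc E); rewrite // ?fE ?inE //; neqs.
    by move: A; rewrite fE !inE; neqs.
- exists (fun w' => [set y; z; w']) => f w' fH wf wU ww c.
  have [wx' wy' wz' wp' wq'] := notin_U wU.
  have [fE wf'] := two f w' fH wf wU ww c; case: fE => // fE.
  + have E : [set y; x; w'] \in H by rewrite set3_swap12 -fE.
    have A : (z \in [set y; z; w]) = (z \in [set x; p; q]).
      by apply: (pcfree_bits pc E); rewrite // ?fE ?inE //; neqs.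
    by move: A; rewrite !inE; neqs.
  + have E : [set z; y; w] \in H by tri.
    have A : (x \in f) = (x \in [set y; p; q]).
      by apply: (pcfree_bits pc E); rewrite // ?fE ?inE //; neqs.
    by move: A; rewrite fE !inE; neqs.
Qed.

Lemma pair_edge_of_two f w : f \in H -> w \in f -> w \notin U ->
  (x \in f) + (y \in f) + (z \in f) = 2 -> pair_edge w.
Proof.
have [[xy xz xp xq] [yz yp yq] zp zq pq] := neqs5.
move=> fH wf /notin_U[wx wy wz wp wq].
have c3 a b : a \in f -> b \in f -> a != b -> w != a -> w != b -> [set a; b; w] \in H.
  move=> af bf ab wa wb; rewrite -(card3_eq (pc.1 f fH)) //; neqs.
rewrite /pair_edge.
case xf: (x \in f); case yf: (y \in f); case zf: (z \in f) => // _.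
- by rewrite (c3 x y).
- by rewrite (c3 x z) ?orbT.
- by rewrite (c3 y z) ?orbT.
Qed.

Variable V : {set T}.
Hypotheses (onV : on H V)
  (IH : forall W : {set T}, W \proper V -> #|within H W| <= fbound #|W|).

(** The core [Q] is [U] with [w] added, and the search bounds it by 8. Since every edge at [w] meets
    [U], an edge crossing [Q] also meets [U] and has one of the two known types: at an outer [v] it
    is [pqv] or [g0 v]. The second occurs only at vertices joined to a pair of [xyz], which form
    [Z]. *)
Lemma six_core w (g0 : T -> {set T}) : w \in V -> w \notin U ->
  pair_edge w || ([set p; q; w] \in H) ->
  (forall g, g \in H -> w \in g -> ~~ [disjoint g & U]) ->
  (forall f w', f \in H -> w' \in f -> w' \notin U -> w' != w ->
     (x \in f) + (y \in f) + (z \in f) = 2 -> f = g0 w') ->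
  below #|V| #|H|.
Proof.
move=> wV wU core inner uniq_pair.
have [wx wy wz wp wq] := notin_U wU; have [[xy xz xp xq] [yz yp yq] zp zq pq] := neqs5.
pose Q := [set v in [:: x; y; z; p; q; w]].
have usw : uniq [:: x; y; z; p; q; w] by neqs.
have Q8 : #|within H Q| <= 8.
  by apply: card_six_pair => //; move: core; rewrite /pair_edge -!orbA.
have xyzV := subsetP (onV xyz); have xpqV := subsetP (onV xpq).
have QV : Q \subset V.
  apply/subsetP => v; rewrite !inE => /or4P[/eqP->|/eqP->|/eqP->|/or3P[]/eqP->] //;
   by [apply: xyzV; rewrite !inE eqxx ?orbT | apply: xpqV; rewrite !inE eqxx ?orbT].
pose Z := [set v in V :\: Q | pair_edge v].
have QU v : v \notin Q -> v \notin U /\ v != w.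
  by rewrite !inE !negb_or => /and5P[-> -> -> -> /andP[-> ->]].
have crossing_type v f : v \in V :\: Q -> f \in crossing H Q v ->
    f = [set p; q; v] \/ f = g0 v /\ pair_edge v.
  rewrite inE => /andP[vQ vV]; rewrite inE => /andP[fH /andP[vf fQ]].
  have [vU vw] := QU v vQ.
  have nd : ~~ [disjoint f & U].
    case wf: (w \in f); first exact: inner.
    move: fQ; apply: contra => fU.
    rewrite disjoint_sym disjoint_subset; apply/subsetP => t; rewrite !inE.
    have [xf yf zf pf qf] := disjoint_U fU.
    by case/or4P=> [/eqP->|/eqP->|/eqP->|/or3P[]/eqP->] //; rewrite wf.
  have nU : ~~ (f \subset U) by apply/subsetPn; exists v.
  case/orP: (pair_edge_type fH nU nd) => [/and5P[pf qf _ _ _]|/and3P[_ _ /eqP c]].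
    left; have [_ _ _ vp vq] := notin_U vU.
    by apply: (card3_eq (pc.1 f fH)) => //; neqs.
  by right; split; [apply: uniq_pair | apply: (pair_edge_of_two fH)].
have -> : #|V| = 6 + #|Z| + #|V :\: Q :\: Z|.
  rewrite -(cardsID Q V) (setIidPr QV) -addnA; congr (_ + _).
    by rewrite cardsE; apply/card_uniqP.
  by rewrite -(cardsID Z (V :\: Q)) (setIidPr _) //; apply/subsetP => v; rewrite inE => /andP[].
apply: below_le (below_six_core _ _).
apply: leq_trans (card_split_le (Z := Z) (Q := Q) (b := 8) onV _ _ _ Q8) _.
- by apply/subsetP => v; rewrite inE => /andP[].
- move=> v vQ; case vZ: (v \in Z).
    apply: leq_trans (_ : #|[set [set p; q; v]; g0 v]| <= _); last by rewrite cards2; case: (_ == _).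
    apply: subset_leq_card; apply/subsetP => f /(crossing_type v f vQ).
    by rewrite !inE => -[->|[-> _]]; rewrite eqxx ?orbT.
  rewrite addn0 -(cards1 [set p; q; v]).
  apply: subset_leq_card; apply/subsetP => f /(crossing_type v f vQ).
  by rewrite !inE => -[->|[_ a]] //; move: vZ; rewrite inE vQ a.
- move=> f; rewrite inE => /andP[fH fQ]; rewrite disjoint_subset; apply/subsetP => v vf.
  rewrite inE; apply/negP; rewrite inE => /andP[]; rewrite inE => /andP[vQ _] a.
  have [vU _] := QU v vQ; have := pair_edge_outside vU a fH vf.
  rewrite disjoint_subset => /negP; apply; apply/subsetP => t tf.
  by have := subsetP fQ t tf; rewrite inE => /andP[/QU[tU _] _]; exact: tU.
rewrite leq_add2l; apply: IH; rewrite properE subDset subsetU ?subsetDl ?orbT //=.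
  by apply/subsetPn; exists w; rewrite // !inE eqxx !orbT andbF.
Qed.


Lemma U_sub_V : U \subset V.
Proof.
have xyzV := subsetP (onV xyz); have xpqV := subsetP (onV xpq).
apply/subsetP => v; rewrite !inE => /or4P[/eqP->|/eqP->|/eqP->|/orP[]/eqP->];
  by [apply: xyzV; rewrite !inE eqxx ?orbT | apply: xpqV; rewrite !inE eqxx ?orbT].
Qed.

Lemma card_U : #|U| = 5.
Proof. by rewrite cardsE; apply/card_uniqP. Qed.

Lemma proper_VU : V :\: U \proper V.
Proof.
rewrite properE subsetDl /=; apply/subsetPn; exists x; last by rewrite !inE eqxx.
by rewrite (subsetP U_sub_V) // !inE eqxx.
Qed.

(** The edge [g] at [w] missing [U] forbids any edge inside [U] to separate [p] from [q], which
    leaves [xyz], [xpq], [ypq], [zpq]. At an outer vertex [v] only [pqv] can cross. *)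
Lemma five_core w g : w \notin U -> [set p; q; w] \in H -> g \in H -> w \in g ->
  [disjoint g & U] -> (forall v, v \in V -> v \notin U -> ~~ pair_edge v) -> below #|V| #|H|.
Proof.
have [[xy xz xp xq] [yz yp yq] zp zq pq] := neqs5.
move=> wU pqw gH wg gU np; have [wx wy wz wp wq] := notin_U wU.
have [xg yg zg pg qg] := disjoint_U gU.
(* A second vertex of [g]: it lies outside [U], so [g] and an edge inside [U] disagree there. *)
have [i ig iw] : exists2 i, i \in g & i != w.
  have : 0 < #|g :\ w| by have := cardsD1 w g; rewrite wg (pc.1 g gH); case: #|_|.
  by case/card_gt0P => i; rewrite !inE => /andP[? ?]; exists i.
have iU : i \notin U.
  by apply/negP => iU; move: gU; rewrite disjoint_subset => /subsetP/(_ i ig); rewrite inE iU.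
have [ix iy iz ip iq] := notin_U iU.
have U4 : within H U \subset [set [set x; y; z]; [set x; p; q]; [set y; p; q]; [set z; p; q]].
  apply/subsetP => f; rewrite inE => /andP[fH /subsetP fU].
  have nf v : v \notin U -> v \notin f by apply: contra => /fU.
  have wf := nf w wU; have if_ := nf i iU.
  have no a b : [set a; b; w] \in H -> i \notin [set a; b; w] -> a \notin g -> b \notin g -> ~~ ((a \in f) && (b \notin f)).
    move=> E iE ag bg; apply/andP => -[af bf]; have E' : [set a; w; b] \in H by tri.
    have A : (i \in f) = (i \in g).
      by apply: (pcfree_bits pc E'); rewrite // set3_swap23.
    by move: A; rewrite ig (negPf if_).
  have n1 : ~~ ((p \in f) && (q \notin f)) by apply: no; rewrite ?inE //; neqs.
  have n2 : ~~ ((q \in f) && (p \notin f)).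
    by apply: no; rewrite ?inE //; first tri; neqs.
  have c3 a b c : a \in f -> b \in f -> c \in f -> uniq [:: a; b; c] -> f = [set a; b; c].
    by move=> *; apply: (card3_eq (pc.1 f fH)).
  case pf: (p \in f); case qf: (q \in f); rewrite ?pf ?qf // in n1 n2.
    have [a aU af] : exists2 a, a \in [:: x; y; z] & a \in f.
      have : 0 < #|f :\: [set p; q]|.
        by rewrite cardsD (pc.1 f fH) subn_gt0 ltnS (leq_trans (subset_leq_card (subsetIr _ _))) // cards2; case: (_ != _).
      case/card_gt0P => a; rewrite !inE => /andP[apq af]; exists a => //.
      by have := fU a af; move: apq; rewrite !inE !orbA negb_or => /andP[/negPf-> /negPf->]; rewrite !orbF.
    rewrite (c3 a p q) //; last by move: aU; rewrite !inE => /or3P[] /eqP ->; neqs.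
    by move: aU; rewrite !inE => /or3P[] /eqP ->; rewrite eqxx ?orbT.
  rewrite !inE (_ : f = [set x; y; z]) ?eqxx //; apply/eqP; rewrite eqEcard card_set3 ?(pc.1 f fH) ?leqnn ?andbT; last by neqs.
  apply/subsetP => t tf; have := fU t tf; rewrite !inE.
  by case/or4P=> [/eqP->|/eqP->|/eqP->|/orP[]/eqP E]; rewrite ?eqxx ?orbT //; move: tf; rewrite E ?pf ?qf.
have cV : #|V| = #|V :\: U| + 5.
  by rewrite -(cardsID U V) (setIidPr U_sub_V) card_U addnC.
have m3 : 3 <= #|V :\: U|.
  by rewrite -(pc.1 g gH); apply: subset_leq_card; rewrite subsetD onV.
rewrite cV; apply: below_le (below_five_core m3).
have B4 : #|within H U| <= 4.
  apply: leq_trans (subset_leq_card U4) _; rewrite -!setUA.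
  apply: leq_trans (leq_card_setU _ _) _; rewrite cards1 ltnS.
  apply: leq_trans (leq_card_setU _ _) _; rewrite cards1 ltnS.
  by rewrite cards2; case: (_ != _).
apply: leq_trans (card_split_le (Z := set0) (Q := U) (b := 4) onV (sub0set _) _ _ B4) _.
- move=> v; rewrite inE => /andP[vU vV]; rewrite inE addn0 -(cards1 [set p; q; v]).
  apply: subset_leq_card; apply/subsetP => f; rewrite !inE => /andP[fH /andP[vf nd]].
  have nU : ~~ (f \subset U) by apply/subsetPn; exists v.
  case/orP: (pair_edge_type fH nU nd) => [/and5P[pf qf _ _ _]|/and3P[_ _ /eqP c]].
    have [_ _ _ vp vq] := notin_U vU.
    by apply/eqP; apply: (card3_eq (pc.1 f fH)) => //; neqs.
  by have := np v vV vU; rewrite (pair_edge_of_two fH vf vU c).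
- by move=> f _; rewrite disjoint_subset; apply/subsetP => t _; rewrite !inE.
rewrite cards0 muln0 addn0 setD0 leq_add2l.
exact: IH proper_VU.
Qed.

(** The first alternative is a family living on the five points of [U] alone, where up to ten edges
    are possible but no two are disjoint. *)
Lemma pair_bound : (#|H| <= 10 /\ ~ matching H) \/ below #|V| #|H|.
Proof.
case: (boolP [exists w in V :\: U, pair_edge w]) => [/exists_inP[w]|np].
  rewrite inE => /andP[wU wV] pw; right.
  have [g0 hg] := pair_edge_unique wU pw.
  by apply: (six_core (w := w) (g0 := g0)) => //; [rewrite pw | move=> g; apply: pair_edge_outside].
have {}np v : v \in V -> v \notin U -> ~~ pair_edge v.
  by move=> vV vU; move/exists_inPn: np; apply; rewrite inE vU.
case: (boolP [exists w in V :\: U, [set p; q; w] \in H]) => [/exists_inP[w]|nq].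
  rewrite inE => /andP[wU wV] pw; right.
  case: (boolP [exists g in H, (w \in g) && [disjoint g & U]]) => [/exists_inP[g gH /andP[wg gU]]|ng].
    exact: (five_core wU pw gH wg gU np).
  (* [set0] is a placeholder: no outer vertex is joined to a pair of [xyz], so the condition on [g0]
     is vacuous. *)
  apply: (six_core (w := w) (g0 := fun=> set0)) => //; first by rewrite pw orbT.
    by move=> g gH wg; move/exists_inPn: ng => /(_ g gH); rewrite wg.
  move=> f w' fH wf wU' _ c; have := np w' (subsetP (onV fH) _ wf) wU'.
  by rewrite (pair_edge_of_two fH wf wU' c).
(* With no edge of either joining type left, [U] is separated from the rest. *)
have sep f : f \in H -> (f \subset U) || [disjoint f & U].
  move=> fH; apply/orP; case: (boolP (f \subset U)) => fU; [by left | right].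
  apply/negPn/negP => nd; have /subsetPn[v vf vU] := fU.
  have vV := subsetP (onV fH) v vf.
  case/orP: (pair_edge_type fH fU nd) => [/and5P[pf qf _ _ _]|/and3P[_ _ /eqP c]].
    have [_ _ _ vp vq] := notin_U vU; have [_ _ _ _ pq] := neqs5.
    move/exists_inPn: nq => /(_ v); rewrite inE vU vV => /(_ isT)/negP; apply.
    by rewrite -(card3_eq (pc.1 f fH)) //; neqs.
  by have := np v vV vU; rewrite (pair_edge_of_two fH vf vU c).
have le : #|H| <= 10 + #|within H (V :\: U)|.
  apply: leq_trans (_ : #|within H U| + #|within H (V :\: U)| <= _).
    apply: leq_trans (leq_card_setU _ _); apply: subset_leq_card; apply/subsetP => f fH.
    by rewrite !inE fH /= subsetD onV //; exact: sep.
  rewrite leq_add2r; have := card_within_binomial (uniform_sub (within_sub H U) pc.1) (@within_on _ H U).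
  by rewrite card_U.
case: (set_0Vmem (within H (V :\: U))) => [E|[g]].
  left; split; first by rewrite E cards0 addn0 in le.
  case=> e [f [eH fH ef]].
  have inU h : h \in H -> h \subset U.
    move=> hH; case/orP: (sep h hH) => // d.
    have : h \in within H (V :\: U) by rewrite inE hH subsetD onV.
    by rewrite E inE.
  have : #|e :|: f| <= #|U| by apply: subset_leq_card; rewrite subUset !inU.
  by rewrite cardsU ef cards0 (pc.1 e eH) (pc.1 f fH) card_U.
rewrite inE => /andP[gH gs]; right.
have cV : #|V| = #|V :\: U| + 5.
  by rewrite -(cardsID U V) (setIidPr U_sub_V) card_U addnC.
have m3 : 3 <= #|V :\: U| by rewrite -(pc.1 g gH); apply: subset_leq_card.
rewrite cV; apply: below_le (below_complete_five m3).
by apply: leq_trans le _; rewrite leq_add2l; exact: IH proper_VU.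
Qed.

End PairCase.

(** * Numerical bounds for the centred case, and the sizes of stars *)

Lemma below_star_union s w : 4 <= s -> 3 <= w -> below (1 + s + w) ('C(s, 2) + fbound w).
Proof.
move=> s4 w3; case: (ltnP (1 + s + w) 11) => h.
  split; last lia.
  by case: w w3 h => [|[|[|[|[|[|[|w]]]]]]]; case: s s4 => [|[|[|[|[|[|[|s]]]]]]] //; lia.
suff h' : 'C(s, 2) + fbound w < gbound (1 + s + w) by split; [exact: ltnW | ].
have [s' E] : exists s', s = s' + 4 by exists (s - 4); lia.
subst s; have := gbound_large h; have := double_bin2 (s' + 4).
have -> : (s' + 4).-1 = s' + 3 by lia.
have -> : 1 + (s' + 4) + w - 4 = s' + w + 1 by lia.
have -> : 1 + (s' + 4) + w - 5 = s' + w by lia.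
set G := gbound _; set C := 'C(_, _); case: (ltnP w 6) => w6.
  have : (w = 3 /\ fbound w = 1) \/ (w = 4 /\ fbound w = 4) \/ (w = 5 /\ fbound w = 10).
    by case: w w3 w6 h G => [|[|[|[|[|[|w]]]]]] //; auto.
  by case=> [[-> ->]|[[-> ->]|[-> ->]]]; move: C G => C G; clear h; nia.
have := fbound_large w6; set F := fbound w.
have [w' E] : exists w', w = w' + 6 by exists (w - 6); lia.
move: F C G; rewrite E => F C G.
have -> : (w' + 6).-1 = w' + 5 by lia. have -> : (w' + 5).-1 = w' + 4 by lia.
nia.
Qed.

(** For [n < 8] both arguments lie in the linear range, where two more vertices add only 4; the last
    term compensates for this. *)
Lemma gboundD2 n : 6 <= n -> gbound n + n <= gbound (n + 2) + 2 + 2 * (n < 8).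
Proof.
move=> n6; case: (ltnP n 11) => h.
  by case: n n6 h => [|[|[|[|[|[|[|[|[|[|[|n]]]]]]]]]]].
have h2 : 11 <= n + 2 by lia.
have := gbound_large h; have := gbound_large h2; set G := gbound n; set G2 := gbound _.
have [m ->] : exists m, n = m + 11 by exists (n - 11); lia.
have -> : m + 11 - 4 = m + 7 by lia. have -> : m + 11 - 5 = m + 6 by lia.
have -> : m + 11 + 2 - 4 = m + 9 by lia. have -> : m + 11 + 2 - 5 = m + 8 by lia.
nia.
Qed.

Lemma below_isolated_pair n d : 1 <= d -> d + 6 <= n -> below n (d + gbound (n - 2)).
Proof.
move=> d1 dn; case: (ltnP n 8) => n8.
  have -> : n = 7 by lia. have -> : d = 1 by lia. by split.
have := @gboundD2 (n - 2) ltac:(lia); have -> : n - 2 + 2 = n by lia.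
move=> H.
by split; case: (ltnP (n - 2) 8) H; lia.
Qed.

(** The value [2 * n - 4] is the sum of [n - 2] edges through a pair and an oddtown family on the
    other [n - 2] vertices; it also dominates the plain oddtown bound [n]. *)
Lemma below_oddtown n : 6 <= n -> below n (2 * n - 4).
Proof.
move=> n6; case: (ltnP n 11) => h.
  by split; [case: n n6 h => [|[|[|[|[|[|[|[|[|[|[|n]]]]]]]]]]] | lia].
have := gbound_large h; set G := gbound n => E.
suff : 2 * n - 4 < G by split; [exact: ltnW|].
have [m E2] : exists m, n = m + 11 by exists (n - 11); lia.
move: E; rewrite E2; have -> : m + 11 - 4 = m + 7 by lia. have -> : m + 11 - 5 = m + 6 by lia.
nia.
Qed.

Lemma below_pair_star n d t : 6 <= n -> d + t + 2 <= n -> t + 4 <= n -> below n (d + 'C(t, 2)).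
Proof.
move=> n6 h1 h2; case: (ltnP n 11) => h.
  split; last lia.
  apply: (@leq_trans (n - 2 - t + 'C(t, 2))); first by rewrite leq_add2r; lia.
  by move: h2 {h1}; case: n n6 h => [|[|[|[|[|[|[|[|[|[|[|n]]]]]]]]]]] //;
     case: t => [|[|[|[|[|[|[|t]]]]]]] //; lia.
have := gbound_large h; set G := gbound n => E.
suff : d + 'C(t, 2) < G by split; [exact: ltnW|].
have [m E2] : exists m, n = t + 4 + m by exists (n - t - 4); lia.
have := double_bin2 t; set C := 'C(_, _).
move: E; rewrite E2; have -> : t + 4 + m - 4 = t + m by lia.
case: t h1 h2 E2 C => [|t] h1 h2 E2 C; first by have -> : 0 + 4 + m - 5 = m.-1; [lia | nia].
have -> : t.+1 + 4 + m - 5 = t + m by lia. rewrite /=; nia.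
Qed.

(** At [m = 5] the inequality fails: a complete family on five points gives 14, while [gbound 8] is
    12. *)
Lemma gbound_comet m : 3 <= m -> m != 5 -> 4 + fbound m <= gbound (m + 3).
Proof.
move=> m3 m5; case: (ltnP m 8) => h; first by case: m m3 m5 h => [|[|[|[|[|[|[|[|m]]]]]]]].
have h1 : 11 <= m + 3 by lia. have h2 : 6 <= m by lia.
have := gbound_large h1; have := fbound_large h2.
have -> : m + 3 - 4 = m.-1 by lia. have -> : m + 3 - 5 = m.-2 by lia.
by set F := fbound _; set G := gbound _; lia.
Qed.

Lemma gbound_comet_eq m : 8 <= m -> gbound (m + 3) = 4 + fbound m.
Proof.
move=> h; have h1 : 11 <= m + 3 by lia. have h2 : 6 <= m by lia.
have := gbound_large h1; have := fbound_large h2.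
have -> : m + 3 - 4 = m.-1 by lia. have -> : m + 3 - 5 = m.-2 by lia.
by set F := fbound _; set G := gbound _; lia.
Qed.

Section Stars.
Variable T : finType.
Implicit Types (a b c x : T) (e f S W : {set T}) (K : {set {set T}}).

Lemma star_card K c S : uniform K -> (forall e, e \in K -> c \in e /\ e \subset c |: S) ->
  #|K| <= 'C(#|S|, 2).
Proof.
move=> u h; rewrite -cards_draws -(card_in_imset (f := fun e => e :\ c) (D := K)).
  apply: subset_leq_card; apply/subsetP => _ /imsetP[e eK ->].
  have [ce es] := h e eK; rewrite inE subDset es /=.
  by have := cardsD1 c e; rewrite ce (u e eK); case: #|_| => [|[|[|]]].
move=> e f eK fK E; have [ce _] := h e eK; have [cf _] := h f fK.
by rewrite -(setD1K ce) E setD1K.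
Qed.

Lemma pair_star_card K a b W : uniform K -> a != b ->
  (forall e, e \in K -> [/\ a \in e, b \in e & e \subset a |: (b |: W)]) -> #|K| <= #|W|.
Proof.
move=> u ab h; apply: leq_trans (leq_imset_card (fun x => [set a; b; x]) W).
apply: subset_leq_card; apply/subsetP => e eK; have [ae be /subsetP es] := h e eK.
have : 0 < #|e :\: [set a; b]|.
  rewrite cardsD (u e eK) subn_gt0 ltnS (leq_trans (subset_leq_card (subsetIr _ _))) //.
  by rewrite cards2; case: (_ != _).
case/card_gt0P => x; rewrite !inE negb_or => /andP[/andP[xa xb] xe].
apply/imsetP; exists x.
  by have := es x xe; rewrite !inE (negPf xa) (negPf xb).
by apply: (card3_eq (u e eK)) => //; neqs.
Qed.

End Stars.

(** * Centred families *)

(** Only containment in a comet is recorded; the number of edges turns it into equality later. *)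
Definition comet_shape (T : finType) (H : {set {set T}}) := exists (c : T) (A : {set T}),
  [/\ c \notin A, #|A| = 3 & forall e, e \in H -> e \subset c |: A \/ c \in e /\ [disjoint e & A]].

Section Centred.
Variable T : finType.
Implicit Types (a b c d t u v w z : T) (e f g h S W V : {set T}) (H K : {set {set T}}).

Lemma set1I_left e f c : e :&: f = [set c] -> c \in e.
Proof. by move=> E; have := set11 c; rewrite -E inE => /andP[]. Qed.

Lemma set1I_right e f c : e :&: f = [set c] -> c \in f.
Proof. by rewrite setIC; apply: set1I_left. Qed.

Lemma set1I_eq e f c t : e :&: f = [set c] -> t \in e -> t \in f -> t = c.
Proof. by move=> E te tf; apply/set1P; rewrite -E inE te. Qed.

Lemma edge_with_two e c a : #|e| = 3 -> c \in e -> a \in e -> c != a ->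
  exists b, [/\ b != c, b != a & e = [set c; a; b]].
Proof.
move=> e3 ce ae ca; have : 0 < #|e :\: [set c; a]|.
  rewrite cardsD e3 subn_gt0 ltnS (leq_trans (subset_leq_card (subsetIr _ _))) //.
  by rewrite cards2; case: (_ != _).
case/card_gt0P => b; rewrite !inE negb_or => /andP[/andP[bc ba] be].
by exists b; split=> //; apply: card3_eq => //; neqs.
Qed.

(** If [g] contained just one of [a], [b], then [cab] would meet [g] in that vertex alone and [e']
    in [c] alone, against centring. *)
Lemma centre_link H c a b e' g : uniform H -> centred H -> [set c; a; b] \in H -> e' \in H ->
  [set c; a; b] :&: e' = [set c] -> g \in H -> c \notin g -> (a \in g) = (b \in g).
Proof.
move=> uH cH eH e'H E gH cg; have ce : c \in e' := set1I_right E.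
have := set3_uniq (uH _ eH); rewrite /= !inE negb_or => /and3P[/andP[ca cb] ab _].
have ae : a \notin e'.
  apply/negP => h; have := set1I_eq E _ h; rewrite !inE eqxx orbT => /(_ isT)/eqP.
  by rewrite eq_sym (negPf ca).
have be : b \notin e'.
  apply/negP => h; have := set1I_eq E _ h; rewrite !inE eqxx orbT => /(_ isT)/eqP.
  by rewrite eq_sym (negPf cb).
have E1 : [set a; c; b] \in H by tri. have E2 : [set b; c; a] \in H by tri.
case ag: (a \in g); case bg: (b \in g) => //.
- by case: (centred_bits cH E1 gH e'H); rewrite ?ag ?bg.
- by case: (centred_bits cH E2 gH e'H); rewrite ?ag ?bg.
Qed.

(** Let [e] and [f] meet in [c] alone. An edge [g] missing [c] meets both, hence contains both pairs
    [e \ c] and [f \ c] by [centre_link], which makes four vertices. *)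
Lemma centred_intersecting K : uniform K -> centred K -> ~ matching K ->
  (forall e f, e \in K -> f \in K -> #|e :&: f| <> 1) \/
  exists c e f, [/\ e \in K, f \in K, e :&: f = [set c] & forall g, g \in K -> c \in g].
Proof.
move=> uK cK nm.
case: (boolP [exists e in K, exists f in K, #|e :&: f| == 1]); last first.
  move=> N; left=> e f eK fK /eqP ef; move/exists_inPn: N => /(_ e eK)/exists_inPn/(_ f fK).
  by rewrite ef.
case/exists_inP => e eK /exists_inP[f fK /cards1P[c ef]]; right.
exists c, e, f; split=> // g gK; apply/negPn/negP => cg.
have big e1 f1 : e1 \in K -> f1 \in K -> e1 :&: f1 = [set c] -> e1 :\ c \subset g.
  move=> e1K f1K ef1; have ce := set1I_left ef1.
  have [E0|[a]] := set_0Vmem (e1 :\ c).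
    by have := cardsD1 c e1; rewrite ce (uK e1 e1K) E0 cards0.
  rewrite !inE => /andP[ac ae].
  have [b [bc ba eE]] := edge_with_two (uK _ e1K) ce ae ltac:(by rewrite eq_sym).
  have e1K' := e1K; rewrite eE in e1K' ef1.
  have A := centre_link uK cK e1K' f1K ef1 gK cg.
  have [E0|[t]] := set_0Vmem (e1 :&: g); first by case: nm; exists e1, g.
  rewrite eE !inE => /andP[/orP[/orP[]|]/eqP -> tg]; first by rewrite tg in cg.
    by apply/subsetP => s; rewrite !inE => /andP[/negPf-> /orP[]/eqP->] //; rewrite -A.
  by apply/subsetP => s; rewrite !inE => /andP[/negPf-> /orP[]/eqP->] //; rewrite A.
have se := big e f eK fK ef; have sf := big f e fK eK ltac:(by rewrite setIC).
have : #|(e :\ c) :|: (f :\ c)| <= #|g| by apply: subset_leq_card; rewrite subUset se sf.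
have -> : (e :\ c) :|: (f :\ c) = (e :|: f) :\ c by rewrite setDUl.
have cef : c \in e :|: f by rewrite inE (set1I_left ef).
have := cardsD1 c (e :|: f); rewrite cef cardsU ef cards1 (uK e) // (uK f) // (uK g) //.
by case: #|(e :|: f) :\ c| => [|[|[|[|]]]].
Qed.

(** * Reductions of a centred family, under the induction hypotheses *)

Section Bounds.
Variables (H : {set {set T}}) (V : {set T}).
Hypotheses (pc : pcfree H) (cH : centred H) (onV : on H V).
Hypothesis IHf : forall W, W \proper V -> #|within H W| <= fbound #|W|.
Hypothesis IHs : forall W, W \proper V -> 8 <= #|W| -> #|within H W| = fbound #|W| ->
  exists c, forall e, e \in within H W -> c \in e.
Hypothesis IHg : forall W, W \proper V -> matching (within H W) -> #|within H W| <= gbound #|W|.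

Let uH : uniform H := pc.1.

(** The edges are the consecutive triples of the sequence [z], [b], [a], [c], [d], [e]. *)
Definition tight_path (a b c d e z : T) :=
  [/\ uniq [:: a; b; c; d; e; z], [set a; b; z] \in H, [set a; b; c] \in H,
      [set a; c; d] \in H & [set c; d; e] \in H].

(** The edges [abz] and [cde] are disjoint, so the search gives at most 8 edges on the six points.
    Centring leaves [abv] and [cdv] as the only crossing edges at an outer [v], and not both: [cdv]
    would meet [abc] in [c] alone and [abv] in [v] alone. *)
Lemma tight_path_bound (a b c d e z : T) : tight_path a b c d e z -> below #|V| #|H|.
Proof.
case=> us abz abc acd cde; have us' := us; move: us'.
rewrite /= !inE !negb_or -!andbA => /and5P[ab ac ad ae /and5P[az bc bd be /and5P[bz cd ce cz /and3P[de dz /andP[ez _]]]]].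
pose Q := [set v in [:: a; b; z; c; d; e]].
have Q8 : #|within H Q| <= 8 by apply: card_six_disjoint => //; neqs.
have in3 f r s t : f \in H -> r \in f -> s \in f -> t \in f -> uniq [:: r; s; t] -> f = [set r; s; t].
  by move=> fH *; apply: card3_eq => //; apply: uH.
have part e1 x y t g : [set x; y; t] \in H -> g \in H -> x \notin g -> y \in g -> t \notin g ->
   e1 \in H -> ~~ [&& x \in e1, y \notin e1 & t \notin e1].
  move=> E gH xg yg tg e1H; apply/and3P => -[xe ye te].
  exact: (centred_bits cH E e1H gH).
have type f v : f \in H -> v \in f -> v \in V :\: Q -> ~~ [disjoint f & Q] ->
    f = [set a; b; v] \/ f = [set c; d; v].
  move=> fH vf; rewrite !inE !negb_or -!andbA => /and5P[va vb vz vc /and3P[vd ve vV]] nd.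
  have A1 : ~~ [&& a \in f, c \notin f & b \notin f].
    by apply: (part f a c b [set c; d; e]); rewrite ?inE //; first tri; neqs.
  have A2 : ~~ [&& b \in f, c \notin f & a \notin f].
    by apply: (part f b c a [set c; d; e]); rewrite ?inE //; first tri; neqs.
  have A3 : ~~ [&& c \in f, a \notin f & d \notin f].
    by apply: (part f c a d [set a; b; z]); rewrite ?inE //; first tri; neqs.
  have A4 : ~~ [&& d \in f, a \notin f & c \notin f].
    by apply: (part f d a c [set a; b; z]); rewrite ?inE //; first tri; neqs.
  have A5 : ~~ [&& d \in f, c \notin f & e \notin f].
    by apply: (part f d c e [set a; b; c]); rewrite ?inE //; first tri; neqs.
  have A6 : ~~ [&& e \in f, c \notin f & d \notin f].
    by apply: (part f e c d [set a; b; c]); rewrite ?inE //; first tri; neqs.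
  have A7 : ~~ [&& b \in f, a \notin f & z \notin f].
    by apply: (part f b a z [set a; c; d]); rewrite ?inE //; first tri; neqs.
  have A8 : ~~ [&& z \in f, a \notin f & b \notin f].
    by apply: (part f z a b [set a; c; d]); rewrite ?inE //; first tri; neqs.
  have A9 : ~~ [&& a \in f & c \in f].
    apply/negP => /andP[af cf]; have fE := in3 f a c v fH af cf vf ltac:(by neqs).
    rewrite fE in fH; apply: (centred_bits cH fH abz cde); rewrite !inE; neqs.
  have two r s t : uniq [:: v; r; s; t] -> ~~ [&& r \in f, s \in f & t \in f].
    move=> u; apply/and3P => -[rf sf tf].
    have : #|[set w in [:: v; r; s; t]]| <= #|f|.
      apply: subset_leq_card; apply/subsetP => w; rewrite !inE.
      by case/or4P => /eqP ->.
    by rewrite (uH fH) cardsE (card_uniqP u).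
  have ND : [|| a \in f, b \in f, z \in f, c \in f, d \in f | e \in f].
    move: nd; rewrite disjoint_sym disjoint_subset => /subsetPn[t]; rewrite !inE negbK => tU tf.
    by case/or4P: tU => [/eqP <-|/eqP <-|/eqP <-|/or3P[]/eqP <-]; rewrite tf ?orbT.
  have B1 := two a b d ltac:(by neqs). have B2 := two b c d ltac:(by neqs).
  have B3 := two a b z ltac:(by neqs). have B4 := two a b e ltac:(by neqs).
  have B5 := two c d z ltac:(by neqs). have B6 := two c d e ltac:(by neqs).
  have B7 := two a d z ltac:(by neqs). have B8 := two a d e ltac:(by neqs).
  have B9 := two b c z ltac:(by neqs). have C1 := two b c e ltac:(by neqs).
  have C2 := two b z d ltac:(by neqs). have C3 := two b z e ltac:(by neqs).
  have C4 := two c e z ltac:(by neqs). have C5 := two d e z ltac:(by neqs).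
  have : (a \in f) && (b \in f) || (c \in f) && (d \in f).
    move: ND A1 A2 A3 A4 A5 A6 A7 A8 A9 B1 B2 B3 B4 B5 B6 B7 B8 B9 C1 C2 C3 C4 C5.
    by do 6![case: (_ \in f)].
  by case/orP => /andP[h1 h2]; [left | right]; apply: in3 => //; neqs.
have QV : Q \subset V.
  have s1 := subsetP (onV abz); have s2 := subsetP (onV cde).
  apply/subsetP => v; rewrite !inE => /or4P[/eqP->|/eqP->|/eqP->|/or3P[]/eqP->] //;
   by [apply: s1; rewrite !inE eqxx ?orbT | apply: s2; rewrite !inE eqxx ?orbT].
have -> : #|V| = 6 + #|@set0 T| + #|V :\: Q|.
  rewrite cards0 addn0 -(cardsID Q V) (setIidPr QV); congr (_ + _).
  by rewrite cardsE; apply/card_uniqP; neqs.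
apply: below_le (below_six_core _ _).
apply: leq_trans (card_split_le (Z := set0) (Q := Q) (b := 8) onV (sub0set _) _ _ Q8) _.
- move=> v vQ; rewrite inE addn0; apply/card_le1_eqP => f g.
  rewrite !inE => /andP[fH /andP[vf fQ]] /andP[gH /andP[vg gQ]].
  have contra_both : [set a; b; v] \in H -> [set c; d; v] \in H -> False.
    move: vQ; rewrite !inE !negb_or -!andbA => /and5P[va vb vz vc /and3P[vd ve vV]].
    move=> h1 h2; have E : [set c; v; d] \in H by tri.
    by apply: (centred_bits cH E abc h1); rewrite !inE; neqs.
  by case: (type f v fH vf vQ fQ) => E1; case: (type g v gH vg vQ gQ) => E2; rewrite E1 E2 // in fH gH *;
     case: contra_both.
- by move=> f _; rewrite disjoint_subset; apply/subsetP => t _; rewrite !inE.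
rewrite setD0 leq_add2l; apply: IHf; rewrite properE subsetDl /=.
by apply/subsetPn; exists a; [rewrite (subsetP QV) // | ]; rewrite !inE eqxx.
Qed.

(** The edges through [c] occupy [c] and its neighbours [S]; the edges missing [c] live on the
    complementary set [W]. The edges [e] and [f] supply four neighbours, and an edge missing [c]
    supplies three vertices of [W]. *)
Lemma unhit_star_bound c e f : e \in H -> f \in H -> e :&: f = [set c] ->
  (exists2 g, g \in H & c \notin g) ->
  (forall g h u, g \in H -> h \in H -> c \notin g -> c \in h -> u \in h -> u != c -> u \notin g) ->
  below #|V| #|H|.
Proof.
move=> eH fH ef [g0 g0H cg0] unhit.
pose S := [set u in V | (u != c) && [exists h in H, (c \in h) && (u \in h)]].
pose W := V :\: (c |: S).
have cV : c \in V by apply: (subsetP (onV eH)); exact: set1I_left ef.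
have cS : c \notin S by rewrite inE eqxx andbF.
have inS h u : h \in H -> c \in h -> u \in h -> u != c -> u \in S.
  move=> hH ch uh uc; rewrite inE (subsetP (onV hH)) // uc.
  by apply/exists_inP; exists h; rewrite // ch.
have outW g : g \in H -> c \notin g -> g \subset W.
  move=> gH cg; apply/subsetP => u ug.
  have uc : u != c by apply: contraNneq cg => <-.
  rewrite in_setD (subsetP (onV gH)) // andbT in_setU1 negb_or uc /=.
  apply/negP; rewrite inE => /andP[_ /andP[_ /exists_inP[h hH /andP[ch uh]]]].
  by move: (unhit g h u gH hH cg ch uh uc); rewrite ug.
have cSV : c |: S \subset V.
  by apply/subsetP => u; rewrite !inE => /orP[/eqP->|/andP[]].
have cardV : #|V| = 1 + #|S| + #|W|.
  by rewrite -(cardsID (c |: S) V) (setIidPr cSV) cardsU1 cS.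
have S4 : 4 <= #|S|.
  have : (e :|: f) :\ c \subset S.
    apply/subsetP => u; rewrite !inE => /andP[uc /orP[ue|uf]].
      by have := inS e u eH (set1I_left ef) ue uc; rewrite inE.
    by have := inS f u fH (set1I_right ef) uf uc; rewrite inE.
  move/subset_leq_card; apply: leq_trans.
  have cef : c \in e :|: f by rewrite inE (set1I_left ef).
  have := cardsD1 c (e :|: f); rewrite cef cardsU ef cards1 (uH eH) (uH fH).
  by case: #|(e :|: f) :\ c| => [|[|[|[|]]]].
have W3 : 3 <= #|W| by rewrite -(uH g0H); apply: subset_leq_card; exact: outW.
rewrite cardV; apply: below_le (below_star_union S4 W3).
apply: leq_trans (_ : #|[set h in H | c \in h]| + #|within H W| <= _).
  apply: leq_trans (leq_card_setU _ _); apply: subset_leq_card; apply/subsetP => h hH.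
  by rewrite !inE hH /=; case ch: (c \in h) => //=; apply: outW; rewrite ?ch.
apply: leq_add.
  apply: (@star_card _ _ c).
    by apply: uniform_sub uH; apply/subsetP => h; rewrite inE => /andP[].
  move=> h; rewrite inE => /andP[hH ch]; split=> //; apply/subsetP => u uh.
  by rewrite in_setU1; case: eqVneq => //= uc; apply: (inS h).
apply: IHf; rewrite properE subsetDl; apply/subsetPn; exists c => //.
by rewrite !inE eqxx.
Qed.

(** [X] is the set of third vertices of the edges containing [uv], and [K] is the family left after
    deleting [u] and [v]. If [K] has a matching, induction applies; if it has no one-point
    intersections, oddtown applies; otherwise it is a star whose edges avoid [X] except possibly at
    the centre. *)
Lemma isolated_pair_bound u v : u != v -> (forall h, h \in H -> (u \in h) = (v \in h)) ->
  (exists2 h, h \in H & u \in h) -> matching H -> below #|V| #|H|.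
Proof.
move=> uv iso [h0 h0H uh0] mH.
pose X := [set t in V | [set u; v; t] \in H]; pose W := V :\: [set u; v].
pose K := within H W.
have uK : uniform K := uniform_sub (within_sub H W) uH.
have cK : centred K := centred_sub (within_sub H W) cH.
have uV : u \in V by apply: (subsetP (onV h0H)).
have vV : v \in V by apply: (subsetP (onV h0H)); rewrite -iso.
have uvV : [set u; v] \subset V by apply/subsetP => t; rewrite !inE => /orP[]/eqP->.
have cardV : #|V| = 2 + #|W| by rewrite -(cardsID [set u; v] V) (setIidPr uvV) cards2 uv.
have Wpr : W \proper V.
  by rewrite properE subsetDl; apply/subsetPn; exists u => //; rewrite !inE eqxx.
have withU h : h \in H -> u \in h -> exists2 t, t \in X & h = [set u; v; t] /\ t \in W.
  move=> hH uh; have vh : v \in h by rewrite -iso.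
  have [t [tu tv hE]] := edge_with_two (uH hH) uh vh uv.
  have tV : t \in V by apply: (subsetP (onV hH)); rewrite hE !inE eqxx orbT.
  by exists t; rewrite !inE ?negb_or ?tu ?tv tV // -hE.
have withoutU h : h \in H -> u \notin h -> h \in K.
  move=> hH uh; rewrite inE hH subsetD onV //= disjoint_sym disjoint_subset.
  by apply/subsetP => t; rewrite !inE => /orP[]/eqP->; rewrite -?iso.
have XW : X \subset W.
  apply/subsetP => t; rewrite !inE => /andP[tV /uH/set3_uniq].
  rewrite /= !inE !negb_or tV => /and3P[/andP[_ ut] vt _].
  by rewrite andbT eq_sym ut eq_sym.
have XH t : t \in X -> [set u; v; t] \in H by rewrite inE => /andP[].
have outK h : h \in K -> [/\ h \in H, u \notin h & v \notin h].
  rewrite inE subsetD => /andP[hH /andP[_ d]]; rewrite hH.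
  by move: d; rewrite disjoint_sym disjoint_subset => /subsetP d; split=> //; apply: d; rewrite !inE eqxx ?orbT.
have cardH : #|H| <= #|X| + #|K|.
  apply: leq_trans (_ : #|(fun t => [set u; v; t]) @: X :|: K| <= _).
    apply: subset_leq_card; apply/subsetP => h hH; rewrite in_setU; apply/orP.
    case uh: (u \in h); last by right; apply: withoutU; rewrite ?uh.
    by left; have [t tX [-> _]] := withU h hH uh; apply: imset_f.
  by apply: leq_trans (leq_card_setU _ _) _; rewrite leq_add2r leq_imset_card.
have XI t h : t \in X -> h \in K -> t \in h -> h :&: [set u; v; t] = [set t].
  move=> tX hK th; have [_ uh vh] := outK h hK.
  by rewrite setIC -set3_swap23 -set3_swap12; apply: setI3_single.
(* For [t] in [X] the edge [uvt] meets an edge of [K] through [t] in [t] alone, so centring allows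
   one such vertex per edge of [K]. *)
have X1 h s t : h \in K -> s \in X -> t \in X -> s \in h -> t \in h -> s = t.
  move=> hK sX tX sh th; apply: set1_inj; have [hH _ _] := outK h hK.
  rewrite -(XI s h) // -(XI t h) //; apply: (cH hH (XH s sX) (XH t tX)).
    by rewrite XI ?cards1.
  by rewrite XI ?cards1.
have X0 : 1 <= #|X|.
  by have [t tX _] := withU h0 h0H uh0; apply/card_gt0P; exists t.
have V6 := matching_card uH onV mH.
have meetX h : h \in K -> 2 <= #|h :\: X|.
  move=> hK; have [hH _ _] := outK h hK; have := cardsID X h; rewrite (uH hH).
  have : #|h :&: X| <= 1.
    by apply/card_le1_eqP => s t /setIP[sh sX] /setIP[th tX]; apply: (X1 h).
  by case: #|_ :&: _| => [|[|]] // _; rewrite ?add0n ?add1n; [move->| case=> ->].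
have [mK|nK] := matching_dec K.
- apply: below_le (below_isolated_pair X0 _).
    apply: leq_trans cardH _; rewrite leq_add2l; have -> : #|V| - 2 = #|W| by rewrite cardV addKn.
    exact: IHg.
  (* Two disjoint edges of [K] have at least two vertices each outside [X], so [W] has at least four
     vertices more than [X]: the side condition of [below_isolated_pair]. *)
  case: mK => e [f [eK fK ef]].
  have : #|(e :\: X) :|: (f :\: X)| <= #|W :\: X|.
    apply: subset_leq_card; rewrite subUset; apply/andP; split; apply: setSD;
      by [apply: (within_on eK) | apply: (within_on fK)].
  rewrite cardsU (_ : _ :&: _ = set0) ?cards0 ?subn0; last first.
    by rewrite -setDIl ef set0D.
  rewrite cardV -(cardsID X W) (setIidPr XW).
  by have := meetX e eK; have := meetX f fK; clear; lia.
have WV : #|W| = #|V| - 2 by rewrite cardV addKn.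
have XleW : #|X| <= #|W| := subset_leq_card XW.
have [no1|[c [e [f [eK fK ef star]]]]] := centred_intersecting uK cK nK.
  apply: below_le (below_oddtown V6); apply: leq_trans cardH _.
  have := oddtown uK (@within_on _ H W) no1; rewrite -/K.
  by move: XleW WV V6; clear; lia.
(* Some edge of [K] through [t] meets another edge of [K] in [c] alone, while it meets [uvt] in [t]
   alone: two different centres. *)
have avoid t h : t \in X -> t != c -> h \in K -> t \notin h.
  move=> tX tc hK; apply/negP => th.
  have clash e1 f1 : e1 \in K -> f1 \in K -> e1 :&: f1 = [set c] -> t \in e1 -> False.
    move=> e1K f1K ef1 te; have [e1H _ _] := outK e1 e1K; have [f1H _ _] := outK f1 f1K.
    have := cH e1H f1H (XH t tX); rewrite ef1 (XI t) // !cards1 => /(_ erefl erefl)/set1_inj/eqP.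
    by rewrite eq_sym (negPf tc).
  case te: (t \in e); first exact: (clash e f).
  case tf: (t \in f); first by apply: (clash f e) => //; rewrite setIC.
  have ch := star h hK; have [hH _ _] := outK h hK.
  have [s [sc st hE]] := edge_with_two (uH hH) ch th ltac:(by rewrite eq_sym).
  case se: (s \in e); last first.
    apply: (clash h e) => //; rewrite hE; apply: setI3_single; rewrite ?te ?se //.
    exact: set1I_left ef.
  case sf: (s \in f); last first.
    apply: (clash h f) => //; rewrite hE; apply: setI3_single; rewrite ?tf ?sf //.
    exact: set1I_right ef.
  by move: sc; rewrite (set1I_eq ef se sf) eqxx.
pose S := W :\: X :\ c.
have KS : #|K| <= 'C(#|S|, 2).
  apply: (@star_card _ _ c) => // h hK; split; first exact: star.
  apply/subsetP => t th; rewrite in_setU1; case: eqVneq => //= tc.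
  rewrite !in_setD1 tc in_setD /= (subsetP (within_on hK)) // andbT.
  by apply/negP => tX; move: (avoid t h tX tc hK); rewrite th.
apply: below_le (below_pair_star (d := #|X|) (t := #|S|) V6 _ _).
- by apply: leq_trans cardH _; rewrite leq_add2l.
- have : #|S| <= #|W :\: X| by apply: subset_leq_card; apply: subsetDl.
  have := cardsID X W; rewrite (setIidPr XW).
  by move: cardV; clear; lia.
have cW : c \in W by apply: (subsetP (within_on eK)); exact: set1I_left ef.
have XS : #|X| + #|W :\: X| = #|W| by rewrite -(cardsID X W) (setIidPr XW).
(* If [c] lies in [X], removing it from [W :\: X] gains nothing, and a second element of [X] is
   needed: an edge missing [c] is not in the star [K], hence contains [uv] and a third vertex other
   than [c]. *)
case cX: (c \in X).
  have X2 : 2 <= #|X|.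
    have [h hH ch] : exists2 h, h \in H & c \notin h.
      case: mH => e1 [f1 [e1H f1H ef1]].
      case ce: (c \in e1); last by exists e1; rewrite ?ce.
      by exists f1 => //; apply/negP => cf; have /setP/(_ c) := ef1; rewrite !inE ce cf.
    case uh: (u \in h); last first.
      by move: ch; rewrite star // withoutU // uh.
    have [t tX [hE _]] := withU h hH uh.
    have tc : t != c by apply: contraNneq ch => <-; rewrite hE !inE eqxx orbT.
    have -> : 2 = #|[set t; c]| by rewrite cards2 tc.
    by apply: subset_leq_card; apply/subsetP => s; rewrite in_set2 => /orP[]/eqP->.
  have : #|S| <= #|W :\: X| by apply: subset_leq_card; apply: subsetDl.
  by move: cardV XS X2; clear; lia.
have : c \in W :\: X by rewrite inE cX.
move=> cWX; have := cardsD1 c (W :\: X); rewrite cWX -/S.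
by move: cardV XS X0; clear; lia.
Qed.

Definition comet_bounded := #|H| <= gbound #|V| /\
  (11 <= #|V| -> #|H| = gbound #|V| -> comet_shape H).

Lemma below_comet_bounded : below #|V| #|H| -> comet_bounded.
Proof. by case=> le lt; split=> // /lt + E; rewrite E ltnn. Qed.

(** Every edge meeting [A], the triple [uvz], is shown to lie in [c |: A], so [A] can be deleted at
    the cost of four edges. At equality the remaining family is a full star, and its centre must be
    [c]. *)
Lemma comet_case c u v z u' v' : uniq [:: c; u; v; z; u'; v'] ->
  [set c; u; v] \in H -> [set c; u; z] \in H -> [set c; u'; v'] \in H -> [set u; v; z] \in H ->
  (forall a b c d (e : T) z, ~ tight_path a b c d e z) -> comet_bounded.
Proof.
move=> us cuv cuz cuv' uvz noP; have us' := us; move: us'.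
rewrite /= !inE !negb_or -!andbA => /and5P[cu cv cz cu' /and5P[cv' uv uz uu' /and5P[uv' vz vu' vv' /and3P[zu' zv' /andP[uv2 _]]]]].
pose A := [set u; v; z].
have A3 : #|A| = 3 by apply: card_set3; neqs.
have cA : c \notin A by rewrite !inE; neqs.
have I1 : [set c; u; v] :&: [set c; u'; v'] = [set c] by apply: setI3_single; rewrite !inE; neqs.
have I2 : [set c; u; z] :&: [set c; u'; v'] = [set c] by apply: setI3_single; rewrite !inE; neqs.
(* Without [c], [centre_link] for [cuv] and [cuz] spreads [t] to all of [A]. With [c], the third
   vertex [s] is neither [u'] nor [v'] because of the forbidden tight path, so [cts] meets [cu'v']
   in [c] alone and [centre_link] applied to [uvz] puts [s] in [A]. *)
have split h t : h \in H -> t \in h -> t \in A -> h \subset c |: A.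
  move=> hH th tA; case ch: (c \in h); last first.
    have E1 := centre_link uH cH cuv cuv' I1 hH (negbT ch).
    have E2 := centre_link uH cH cuz cuv' I2 hH (negbT ch).
    have uh : u \in h by move: tA th; rewrite !inE => /orP[/orP[]|]/eqP->; rewrite -?E1 -?E2.
    rewrite (card3_eq (uH hH) (_ : uniq [:: u; v; z])) -?E1 -?E2 //; last by neqs.
    exact: subsetUr.
  have ct : c != t by apply: contraNneq cA => ->.
  have [s [sc st hE]] := edge_with_two (uH hH) ch th ct.
  have path d (e : T) : [set c; d; e] \in H -> uniq [:: c; u; v; z; d; e] -> s != d.
    move=> cde ude; apply/eqP => sd; subst s; move: ude.
    rewrite /= !inE !negb_or -!andbA => /and5P[_ _ _ cd /and5P[ce _ _ ud /and5P[ue _ vd ve /and3P[zd ze /andP[de _]]]]].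
    have ctd : [set t; c; d] \in H by rewrite set3_swap12 -hE.
    move: tA; rewrite !inE => /orP[/orP[]|]/eqP E; subst t.
    + by apply: (noP u v c d e z); split; [neqs | tri ..].
    + by apply: (noP v u c d e z); split; [neqs | tri ..].
    + by apply: (noP z u c d e v); split; [neqs | tri ..].
  have su' : s != u' := path u' v' cuv' us.
  have sv' : s != v'.
    by apply: (path v' u'); [tri | neqs].
  have hc : [set c; t; s] :&: [set c; u'; v'] = [set c].
    have tu' : t != u' by apply: contraTneq tA => ->; rewrite !inE; neqs.
    have tv' : t != v' by apply: contraTneq tA => ->; rewrite !inE; neqs.
    by apply: setI3_single; rewrite !inE; neqs.
  rewrite hE in hH; have := centre_link uH cH hH cuv' hc uvz cA; rewrite -/A tA => sA.
  by rewrite hE; apply/subsetP => r; rewrite in_setU in_set2 in_set1 in_setU1 => /orP[/orP[]|]/eqP->;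
     rewrite ?eqxx // ?tA -?sA orbT.
pose W := V :\: A.
have AV : A \subset V by apply: onV.
have cardV : #|V| = #|W| + 3 by rewrite -(cardsID A V) (setIidPr AV) A3 addnC.
have Wpr : W \proper V.
  rewrite properE subsetDl; apply/subsetPn; exists u; first by rewrite (subsetP AV) // !inE eqxx.
  by rewrite !inE eqxx.
have dichotomy h : h \in H -> h \subset c |: A \/ h \in within H W /\ [disjoint h & A].
  move=> hH; case d: [disjoint h & A]; first by right; rewrite inE hH subsetD onV.
  left; move/negbT: d; rewrite disjoint_subset => /subsetPn[t th]; rewrite inE negbK => tA.
  exact: (split h t).
have le4 : #|H| <= 4 + #|within H W|.
  apply: leq_trans (_ : #|within H (c |: A) :|: within H W| <= _).
    apply: subset_leq_card; apply/subsetP => h hH; rewrite in_setU.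
    by case: (dichotomy h hH) => [s|[-> _]]; rewrite ?orbT // inE hH s.
  apply: leq_trans (leq_card_setU _ _) _; rewrite leq_add2r.
  have := card_within_binomial (uniform_sub (within_sub H (c |: A)) uH) (@within_on _ H (c |: A)).
  by rewrite cardsU1 cA A3.
have cuv'W : [set c; u'; v'] \in within H W.
  rewrite inE cuv' subsetD onV //= disjoint_subset; apply/subsetP => t.
  by rewrite !inE => /orP[/orP[]|]/eqP->; neqs.
have W3 : 3 <= #|W|.
  by rewrite -(uH cuv'); apply: subset_leq_card; move: cuv'W; rewrite inE => /andP[].
(* Since [cuv] meets [cu'v'] in [c] alone, no edge may meet it in [u'] or [v'] alone. *)
have lone s t i j : [set c; s; t] \in H -> uniq [:: c; s; t; i; j; u; v] -> [set s; i; j] \notin H.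
  move=> cst; rewrite /= !inE !negb_or -!andbA => /and5P[cs ct ci cj /and5P[_ _ st si /and5P[sj su sv ti /and5P[tj tu tv ij /and5P[iu iv ju jv _]]]]].
  apply/negP => sij; have E : [set s; c; t] \in H by tri.
  by apply: (centred_bits cH E sij cuv); rewrite !inE; neqs.
have lonely s t i j : [set c; s; t] \in H -> uniq [:: c; s; t; u; v] -> i \in W -> j \in W ->
   uniq [:: c; s; t; i; j] -> [set s; i; j] \notin H.
  move=> cst u5 iW jW u6; apply: (lone s t) => //.
  have inWne r : r \in W -> r != u /\ r != v.
    by rewrite !inE !negb_or => /andP[/andP[/andP[-> ->] _] _].
  have [iu iv] := inWne i iW; have [ju jv] := inWne j jW.
  move: u5 u6; rewrite /= !inE !negb_or -!andbA => /and5P[? ? ? ? /and5P[? ? ? ? /and3P[? ? _]]].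
  by move=> /and5P[? ? ? ? /and5P[? ? ? ? /and3P[? ? _]]]; neqs.
split.
  (* Five remaining vertices are the case in which [fbound] is too weak. The triples joining [u']
     and [v'] to the other two vertices [i], [j] are not edges, which lowers 10 to the required
     8. *)
  case: (eqVneq #|W| 5) => [W5|W5]; last first.
    rewrite cardV; apply: leq_trans (gbound_comet W3 W5); apply: leq_trans le4 _.
    by rewrite leq_add2l; apply: IHf.
  rewrite cardV W5; apply: leq_trans le4 _; rewrite -[gbound _]/(4 + 8) leq_add2l.
  have : #|W :\: [set c; u'; v']| = 2.
    rewrite cardsD W5 (setIidPr _) ?(uH cuv') //.
    by move: cuv'W; rewrite inE => /andP[].
  move/eqP/cards2P => [i [j [ij ijE]]].
  have inij r : r \in [set i; j] -> [/\ r \in W, r != c, r != u' & r != v'].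
    by rewrite -ijE in_setD => /andP[+ ->]; rewrite !inE !negb_or => /andP[/andP[-> ->] ->].
  have [iW ic iu' iv'] := inij i (set21 i j); have [jW jc ju' jv'] := inij j (set22 i j).
  have e1 : [set u'; i; j] \notin H by apply: (lonely u' v') => //; neqs.
  have e2 : [set v'; i; j] \notin H by apply: (lonely v' u') => //; first tri; neqs.
  have e12 : [set u'; i; j] != [set v'; i; j].
    by apply/eqP => /setP/(_ u'); rewrite !inE; neqs.
  have u'W : u' \in W by move: cuv'W; rewrite inE => /andP[_ /subsetP]; apply; rewrite !inE eqxx orbT.
  have v'W : v' \in W by move: cuv'W; rewrite inE => /andP[_ /subsetP]; apply; rewrite !inE eqxx orbT.
  have sub r : r \in W -> r != i -> r != j -> [set r; i; j] \in [set B : {set T} | B \subset W & #|B| == 3].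
    move=> rW ri rj; rewrite inE card_set3 ?eqxx ?andbT; last by neqs.
    by apply/subsetP => s; rewrite in_setU in_set2 in_set1 => /orP[/orP[]|]/eqP->.
  have := cards_draws W 3; rewrite W5 => D.
  have : within H W \subset [set B : {set T} | B \subset W & #|B| == 3] :\: [set [set u'; i; j]; [set v'; i; j]].
    apply/subsetP => h; rewrite inE => /andP[hH hW]; rewrite !inE hW (uH hH) andbT negb_or.
    by apply/andP; split; apply: contraTneq hH => ->.
  move/subset_leq_card; rewrite cardsD D (setIidPr _) ?cards2 ?e12 //.
  by apply/subsetP => B; rewrite in_set2 => /orP[]/eqP->; apply: sub; rewrite // eq_sym.
move=> V11 E; have W8 : 8 <= #|W| by move: V11 cardV; clear; lia.
have full : #|within H W| = fbound #|W|.
  apply/eqP; rewrite eqn_leq IHf //=.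
  by move: le4; rewrite E cardV gbound_comet_eq // leq_add2l.
have [c' star] := IHs Wpr W8 full.
suff cc : c' = c.
  exists c, A; split=> // h hH; case: (dichotomy h hH) => [s|[hW d]]; [by left|right].
  by rewrite -cc star.
apply/eqP/negPn/negP => cc'.
(* If the star had centre [s] in an edge [cst], an edge missing [c] and [t] would meet [cst] in [s]
   alone, whereas [cuv] meets it in [c] alone. All edges in [W] would then contain [cs] or [st], at
   most [2 * #|W|] in number, which is too few from 8 vertices on. *)
have wrong s t : [set c; s; t] \in H -> uniq [:: c; s; t; u; v] -> c' = s -> False.
  move=> cst u5 cs; subst s.
  pose K1 := [set h in within H W | c \in h]; pose K2 := [set h in within H W | t \in h].
  have [c'c c't] : c' != c /\ c' != t.
    by move: u5; rewrite /= !inE !negb_or -!andbA eq_sym => /and5P[-> _ _ _ /andP[-> _]].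
  have bound K r : K \subset within H W -> c' != r -> (forall h, h \in K -> r \in h) -> #|K| <= #|W|.
    move=> KW cr rK; apply: (@pair_star_card _ _ c' r) => //.
      exact: uniform_sub (subset_trans KW (within_sub _ _)) uH.
    move=> h hK; have hW := subsetP KW h hK; split; rewrite ?star ?rK //.
    by rewrite !setUA; apply: subset_trans (within_on hW) _; apply: subsetUr.
  have : #|within H W| <= #|W| + #|W|.
    apply: leq_trans (_ : #|K1 :|: K2| <= _).
      apply: subset_leq_card; apply/subsetP => h hW; rewrite !inE -andb_orr.
      have := hW; rewrite inE => ->; apply/negPn/negP; rewrite negb_or => /andP[ch th].
      have hH : h \in H by move: hW; rewrite inE => /andP[].
      have E' : [set c'; c; t] \in H by tri.
      have := star h hW => c'h.
      apply: (centred_bits cH E' hH cuv); rewrite ?ch ?th ?c'h // !inE;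
        by move: u5; rewrite /= !inE !negb_or -!andbA => /and5P[? ? ? ? /and5P[? ? ? ? /and3P[? ? _]]]; neqs.
    apply: leq_trans (leq_card_setU _ _) _; apply: leq_add.
      by apply: (bound K1 c) => // [|h]; [apply/subsetP => h|]; rewrite inE => /andP[].
    by apply: (bound K2 t) => // [|h]; [apply/subsetP => h|]; rewrite inE => /andP[].
  have := fbound_large (leq_trans (isT : 6 <= 8) W8); rewrite full.
  by move: W8; move: (fbound #|W|) => F; move: #|W| => w; clear; nia.
have := star _ cuv'W; rewrite !inE (negPf cc') /= => /orP[]/eqP E'.
  by apply: (wrong u' v') => //; neqs.
by apply: (wrong v' u') => //; first tri; neqs.
Qed.

(** An edge [g] missing [c] but touching the star at [c] contains the pair [uv] of some star edge
    [cuv], so it is [uvz]. If [cuz] or [cvz] is an edge, the comet appears; if neither is, no edge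
    separates [u] from [v]. *)
Lemma centred_bound : matching H -> comet_bounded.
Proof.
move=> mH.
have V6 := matching_card uH onV mH.
case: (boolP [exists e in H, exists f in H, #|e :&: f| == 1]); last first.
  move=> N; apply/below_comet_bounded/below_le/below_oddtown/V6.
  apply: leq_trans (oddtown uH onV _) _; last by move: V6; clear; lia.
  move=> e f eH fH /eqP ef; move/exists_inPn: N => /(_ e eH)/exists_inPn/(_ f fH).
  by rewrite ef.
case/exists_inP => e0 e0H /exists_inP[f0 f0H /cards1P[c ef0]].
have [g0 g0H cg0] : exists2 g, g \in H & c \notin g.
  case: mH => e [f [eH fH ef]]; case ce: (c \in e); last by exists e; rewrite ?ce.
  by exists f => //; apply/negP => cf; have /setP/(_ c) := ef; rewrite !inE ce cf.
case: (boolP [exists a, exists b, exists c, exists d, exists e : T, exists z,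
   [&& uniq [:: a; b; c; d; e; z], [set a; b; z] \in H, [set a; b; c] \in H,
      [set a; c; d] \in H & [set c; d; e] \in H]]).
  move=> /existsP[a /existsP[b /existsP[x /existsP[d /existsP[e /existsP[z /and5P[h1 h2 h3 h4 h5]]]]]]].
  by apply: below_comet_bounded; apply: (@tight_path_bound a b x d e z).
move=> NP; have noP a b x d (e : T) z : ~ tight_path a b x d e z.
  case=> h1 h2 h3 h4 h5; case/negP: NP.
  apply/existsP; exists a; apply/existsP; exists b; apply/existsP; exists x.
  apply/existsP; exists d; apply/existsP; exists e; apply/existsP; exists z.
  by apply/and5P.
case: (boolP [exists g in H, exists h in H, exists u,
   [&& c \notin g, c \in h, u \in h, u != c & u \in g]]); last first.
  move=> N; apply: below_comet_bounded; apply: (unhit_star_bound e0H f0H ef0); first by exists g0.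
  move=> g h u gH hH cg ch uh uc; apply/negP => ug; case/negP: N.
  apply/exists_inP; exists g => //; apply/exists_inP; exists h => //; apply/existsP; exists u.
  by rewrite cg ch uh uc.
case/exists_inP => g gH /exists_inP[h hH /existsP[u /and5P[cg ch uh uc ug]]].
(* If [u] is in neither [e0] nor [f0], the third vertex of [h] cannot lie in both, so [h] meets one
   of them in [c] alone. *)
have [e [e' [eH e'H ee' ue]]] : exists e e', [/\ e \in H, e' \in H, e :&: e' = [set c] & u \in e].
  case ue: (u \in e0); first by exists e0, f0.
  case uf: (u \in f0); first by exists f0, e0; split=> //; rewrite setIC.
  have cu : c != u by rewrite eq_sym.
  have [s [sc su hE]] := edge_with_two (uH hH) ch uh cu.
  case se: (s \in e0); last first.
    exists h, e0; split=> //; rewrite hE; apply: setI3_single; rewrite ?ue ?se //.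
    exact: set1I_left ef0.
  exists h, f0; split=> //; rewrite hE; apply: setI3_single; rewrite ?uf //.
    exact: set1I_right ef0.
  by apply/negP => sf; move: sc; rewrite (set1I_eq ef0 se sf) eqxx.
have ce : c \in e := set1I_left ee'. have ce' : c \in e' := set1I_right ee'.
have [v [vc vu eE]] := edge_with_two (uH eH) ce ue ltac:(by rewrite eq_sym).
have [u' [v' [u3' e'E]]] : exists u' v', uniq [:: c; u'; v'] /\ e' = [set c; u'; v'].
  have : 0 < #|e' :\ c| by have := cardsD1 c e'; rewrite ce' (uH e'H); case: #|_|.
  case/card_gt0P => r; rewrite !inE => /andP[rc re].
  have [s [sc sr E]] := edge_with_two (uH e'H) ce' re ltac:(by rewrite eq_sym).
  by exists r, s; split=> //; neqs.
rewrite eE e'E in eH e'H ee'.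
have vg : v \in g by rewrite -(centre_link uH cH eH e'H ee' gH cg).
have [z [zu zv gE]] := edge_with_two (uH gH) ug vg ltac:(by rewrite eq_sym).
have zg : z \in g by rewrite gE !inE eqxx orbT.
have zc : z != c by apply: contraNneq cg => <-.
move: u3'; rewrite /= !inE negb_or => /and3P[/andP[cu' cv'] uv' _].
have ee'c : [set c; u'; v'] :&: [set c; u; v] = [set c] by rewrite setIC.
have outE r : r \in [set u; v] -> r \notin [set c; u'; v'].
  move=> ruv; apply/negP => r'; have rc := set1I_eq ee'c r'.
  by move: ruv (rc); rewrite !inE => /orP[]/eqP E; subst r; rewrite eqxx ?orbT => /(_ isT)/eqP; apply/negP.
have := outE u (set21 u v); have := outE v (set22 u v).
rewrite !inE !negb_or => /andP[/andP[_ vu'] vv'] /andP[/andP[_ uu'] uv''].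
have L' := centre_link uH cH e'H eH ee'c gH cg.
have u'g : u' \notin g.
  apply/negP => u'g; have v'g := u'g; rewrite L' in v'g.
  move: u'g v'g uv'; rewrite gE !inE ![_ == u]eq_sym ![_ == v]eq_sym.
  by rewrite (negPf uu') (negPf vu') (negPf uv'') (negPf vv') /= => /eqP-> /eqP->; rewrite eqxx.
have v'g : v' \notin g by rewrite -L'.
have zu' : z != u' by apply: contraNneq u'g => <-.
have zv' : z != v' by apply: contraNneq v'g => <-.
have us : uniq [:: c; u; v; z; u'; v'] by neqs.
have us2 : uniq [:: c; v; u; z; u'; v'] by neqs.
have uvz : [set u; v; z] \in H by rewrite -gE.
case cuz: ([set c; u; z] \in H); first exact: (comet_case us).
have vuz : [set v; u; z] \in H by tri. have cvu : [set c; v; u] \in H by tri.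
case cvz: ([set c; v; z] \in H); first exact: (comet_case us2).
apply: below_comet_bounded; apply: (@isolated_pair_bound u v) => //; first by rewrite eq_sym.
  (* An edge [h1] with [r] but not [s] contains [c], by [centre_link]. Its third vertex cannot be
     [u'] or [v'], which would give a tight path; otherwise [centre_link] for [h1] forces that
     vertex into [g], which is impossible. *)
  have iso r s h1 : uniq [:: c; r; s; z; u'; v'] -> [set c; r; s] \in H -> [set r; s; z] \in H ->
      [set c; r; z] \notin H -> g = [set r; s; z] -> [set c; r; s] :&: [set c; u'; v'] = [set c] ->
      h1 \in H -> r \in h1 -> s \in h1.
    rewrite /= !inE !negb_or -!andbA => /and5P[cr cs _ _ /and5P[_ rs rz ru' /and5P[rv' sz su' sv' _]]].
    move=> crs rsz ncrz gE' I h1H rh; apply/negPn/negP => sh.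
    have ch1 : c \in h1.
      by apply/negPn/negP => ch1; move: sh; rewrite -(centre_link uH cH crs e'H I h1H ch1) rh.
    have [t [tc tr h1E]] := edge_with_two (uH h1H) ch1 rh cr.
    have tz : t != z by apply: contraNneq ncrz => <-; rewrite -h1E.
    have ts : t != s by apply: contraNneq sh => <-; rewrite h1E !inE eqxx orbT.
    have cz : c != z by rewrite eq_sym.
    case: (eqVneq t u') => [tu'|tu'].
      apply: (noP r s c u' v' z); split; [by neqs | by [] | by tri | | by []].
      by rewrite set3_swap12 -tu' -h1E.
    case: (eqVneq t v') => [tv'|tv'].
      apply: (noP r s c v' u' z); split; [by neqs | by [] | by tri | | by tri].
      by rewrite set3_swap12 -tv' -h1E.
    rewrite h1E in h1H.
    have I1 : [set c; r; t] :&: [set c; u'; v'] = [set c] by apply: setI3_single; rewrite !inE; neqs.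
    have := centre_link uH cH h1H e'H I1 gH cg.
    by rewrite gE' !inE eqxx (negPf tr) (negPf ts) (negPf tz).
  move=> h1 h1H; apply/idP/idP.
    by apply: iso; rewrite ?cuz.
  apply: iso; rewrite ?cvz //; first by rewrite set3_swap12.
  by rewrite -set3_swap23.
by exists g.
Qed.

End Bounds.

End Centred.

(** * The bounds *)

Lemma gbound_le_fbound n : 6 <= n -> gbound n + (8 <= n) <= fbound n.
Proof.
move=> n6; case: (ltnP n 11) => h.
  by case: n n6 h => [|[|[|[|[|[|[|[|[|[|[|n]]]]]]]]]]].
have -> : 8 <= n by lia.
have := gbound_large h; have := fbound_large n6.
have [m ->] : exists m, n = m + 11 by exists (n - 11); lia.
have -> : m + 11 - 4 = m + 7 by lia. have -> : m + 11 - 5 = m + 6 by lia.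
have -> : (m + 11).-1 = m + 10 by lia. have -> : (m + 10).-1 = m + 9 by lia.
set F := fbound _; set G := gbound _; nia.
Qed.

(** The two ways to have no matching without being a star: ten edges on five points, or at most [n]
    edges by oddtown. At [n = 6] the ten edges equal [fbound], so strictness cannot start there. *)
Lemma max_le_fbound n : 6 <= n -> maxn 10 n + (8 <= n) <= fbound n.
Proof.
move=> n6; case: (ltnP n 11) => h.
  by case: n n6 h => [|[|[|[|[|[|[|[|[|[|[|n]]]]]]]]]]].
have -> : 8 <= n by lia.
have := fbound_large n6.
have [m ->] : exists m, n = m + 11 by exists (n - 11); lia.
have -> : (m + 11).-1 = m + 10 by lia. have -> : (m + 10).-1 = m + 9 by lia.
have -> : maxn 10 (m + 11) = m + 11 by lia.
set F := fbound _; nia.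
Qed.

Section Main.
Variable T : finType.
Implicit Types (V W : {set T}) (H : {set {set T}}).

Lemma pcfree_bounds V H : on H V -> pcfree H ->
  [/\ #|H| <= fbound #|V|,
      8 <= #|V| -> #|H| = fbound #|V| -> exists c, forall e, e \in H -> c \in e
    & matching H -> comet_bounded H V].
Proof.
have [n] := ubnP #|V|; elim: n V H => // n IHn V H /ltnSE-Vn onV pc.
have IH W : W \proper V -> [/\ #|within H W| <= fbound #|W|,
      8 <= #|W| -> #|within H W| = fbound #|W| -> exists c, forall e, e \in within H W -> c \in e
    & matching (within H W) -> comet_bounded (within H W) W].
  move=> WV; apply: IHn; first exact: leq_trans (proper_card WV) Vn.
    exact: within_on.
  exact: pcfree_sub (within_sub _ _) pc.
have IHf W : W \proper V -> #|within H W| <= fbound #|W| by case/IH.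
have IHs W : W \proper V -> 8 <= #|W| -> #|within H W| = fbound #|W| ->
    exists c, forall e, e \in within H W -> c \in e by case/IH.
have IHg W : W \proper V -> matching (within H W) -> #|within H W| <= gbound #|W|.
  by case/IH => _ _ h /h[].
have cb : matching H -> comet_bounded H V.
  move=> mH; case: (centred_or_pair pc) => [cH|]; first exact: centred_bound.
  case=> x [y [z [p [q [us xyz xpq ypq]]]]].
  by case: (pair_bound pc us xyz xpq ypq onV IHf) => [[]|/below_comet_bounded].
case: (ltnP #|V| 6) => V6.
  split=> //; last by rewrite leqNgt (leq_trans V6).
  by rewrite /fbound V6; apply: card_within_binomial => //; case: pc.
(* A slack of one from 8 vertices on excludes equality, so the first two claims follow from this
   alternative. *)
suff [le|[c star]] : #|H| + (8 <= #|V|) <= fbound #|V| \/ exists c, forall e, e \in H -> c \in e.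
- split=> //; first exact: leq_trans (leq_addr _ _) le.
  by move=> V8 E; move: le; rewrite E V8 addn1 ltnn.
- split=> //; last by exists c.
  case: (set_0Vmem H) => [->|[e eH]]; first by rewrite cards0.
  have cV : c \in V by apply: (subsetP (onV e eH)); apply: star.
  rewrite /fbound ltnNge V6 /= (_ : #|V|.-1 = #|V :\ c|).
    apply: (@star_card _ _ c) => [|f fH]; first by case: pc.
    by rewrite setD1K // star // onV.
  by have := cardsD1 c V; rewrite cV => ->.
case: (matching_dec H) => mH.
  left; apply: leq_trans (gbound_le_fbound V6).
  by rewrite leq_add2r; case: (cb mH).
have small m : m <= maxn 10 #|V| -> m + (8 <= #|V|) <= fbound #|V|.
  by move=> le; apply: leq_trans (max_le_fbound V6); rewrite leq_add2r.
case: (centred_or_pair pc) => [cH|].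
  case: (centred_intersecting pc.1 cH mH) => [no1|[c [_ [_ [_ _ _ star]]]]].
    by left; apply: small; rewrite leq_max (oddtown pc.1 onV no1) orbT.
  by right; exists c.
case=> x [y [z [p [q [us xyz xpq ypq]]]]]; left.
case: (pair_bound pc us xyz xpq ypq onV IHf) => [[le _]|[le _]].
  by apply: small; rewrite leq_max le.
by apply: leq_trans (gbound_le_fbound V6); rewrite leq_add2r.
Qed.

End Main.

(** * Extremal families and the comet *)

Section Avoidance.
Variable T : finType.
Implicit Types (e f g A B : {set T}) (H : {set {set T}}).

Lemma triI k a b c a' b' c' x : x <= k ->
  all (fun i => ((i == a) || (i == b) || (i == c)) && ((i == a') || (i == b') || (i == c')) == (i == x)) (iota 0 k.+1) ->
  all (fun i => i <= k) [:: a; b; c; a'; b'; c'] ->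
  tri k a b c :&: tri k a' b' c' = [set inord x].
Proof.
move=> xk /allP h /= /and5P[? ? ? ? /and3P[? ? _]].
apply/setP => t; rewrite !inE -!val_eqE /= !inordK //.
by apply/eqP; apply: h; rewrite mem_iota ltn_ord.
Qed.

Lemma not_contains_path H :
  (forall e f g, e \in H -> f \in H -> g \in H -> #|e :&: f| = 1 -> #|f :&: g| = 1 ->
     e :&: g != set0) -> ~ contains Ppath H.
Proof.
move=> h [f [fi fH]].
have I (B1 B2 : {set 'I_7}) : f @: B1 :&: f @: B2 = f @: (B1 :&: B2) by rewrite imsetI // => ? ? _ _; apply: fi.
have := h (f @: tri 6 0 1 2) (f @: tri 6 2 3 4) (f @: tri 6 4 5 6).
rewrite !I (@triI 6 0 1 2 2 3 4 2) // (@triI 6 2 3 4 4 5 6 4) // !imset_set1 !cards1.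
rewrite !fH ?inE ?eqxx ?orbT // => /(_ isT isT isT erefl erefl)/negP; apply.
rewrite (_ : _ :&: _ = set0) ?imset0 //.
by apply/setP => t; rewrite !inE -!val_eqE /= !inordK //; case: t => [[|[|[|[|[|[|[|]]]]]]]].
Qed.

Lemma not_contains_triangle H :
  (forall e f g, e \in H -> f \in H -> g \in H -> #|e :&: f| = 1 -> #|f :&: g| = 1 ->
     #|e :&: g| = 1 -> e :&: f :&: g != set0) -> ~ contains Ctri H.
Proof.
move=> h [f [fi fH]].
have I (B1 B2 : {set 'I_6}) : f @: B1 :&: f @: B2 = f @: (B1 :&: B2) by rewrite imsetI // => ? ? _ _; apply: fi.
have := h (f @: tri 5 0 5 1) (f @: tri 5 1 3 2) (f @: tri 5 2 4 0).
rewrite !I (@triI 5 0 5 1 1 3 2 1) // (@triI 5 1 3 2 2 4 0 2) // (@triI 5 0 5 1 2 4 0 0) //.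
rewrite !imset_set1 !cards1 !fH ?inE ?eqxx ?orbT // => /(_ isT isT isT erefl erefl erefl)/negP; apply.
rewrite (_ : _ :&: _ = set0) ?imset0 //; apply/setP => t.
by rewrite !inE -!val_eqE /= !inordK //; case: t => [[|[|[|[|[|[|]]]]]]].
Qed.

(** All triples containing [ab] or [cd]. One-point intersections occur only between the two classes,
    so three edges cannot pairwise meet in single vertices, and the end edges of a path would share
    [a] or [c]. *)
Lemma two_pairs_family (a b c d x y : T) : uniq [:: a; b; c; d; x; y] ->
  exists H, [/\ uniform H, ~ contains Ppath H, ~ contains Ctri H, matching H & #|H| = 2 * #|T| - 4].
Proof.
move=> us; have us' := us; move: us'.
rewrite /= !inE !negb_or -!andbA => /and5P[ab ac ad ax /and5P[ay bc bd bx /and5P[b_y cd cx cy /and3P[dx dy /andP[xy _]]]]].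
pose F (p q : T) := (fun t => [set p; q; t]) @: (~: [set p; q]).
have Fin p q e : e \in F p q -> p \in e /\ q \in e.
  by case/imsetP => t _ ->; rewrite !inE !eqxx ?orbT.
have Fmem p q t : t != p -> t != q -> [set p; q; t] \in F p q.
  by move=> tp tq; apply/imsetP; exists t; rewrite // !inE negb_or tp.
have Fcard p q : p != q -> #|F p q| = #|T| - 2.
  move=> pq; rewrite card_in_imset; first by rewrite cardsCs setCK cards2 pq.
  move=> s t; rewrite !inE !negb_or => /andP[sp sq] /andP[tp tq] /setP/(_ s).
  by rewrite !inE eqxx (negPf sp) (negPf sq) /= => /esym/eqP.
have F3 p q e : p != q -> e \in F p q -> #|e| = 3.
  by move=> pq /imsetP[t]; rewrite !inE negb_or => /andP[tp tq] ->; apply: card_set3; neqs.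
have both p q e f : p != q -> e \in F p q -> f \in F p q -> #|e :&: f| != 1.
  move=> pq /Fin[pe qe] /Fin[pf qf]; apply/negP => /eqP E.
  have : #|[set p; q]| <= #|e :&: f|.
    by apply: subset_leq_card; apply/subsetP => t; rewrite in_set2 inE => /orP[]/eqP->; apply/andP.
  by rewrite E cards2 pq.
pose H := F a b :|: F c d.
have other e f : e \in H -> f \in H -> #|e :&: f| = 1 -> (f \in F a b) = (e \notin F a b).
  rewrite !in_setU => eH fH E.
  case e1: (e \in F a b); case f1: (f \in F a b) => //.
    by move: (both _ _ _ _ ab e1 f1); rewrite E.
  by rewrite e1 in eH; rewrite f1 in fH; move: (both _ _ _ _ cd eH fH); rewrite E.
exists H; split.
- by move=> e; rewrite in_setU => /orP[]; apply: F3.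
- apply: not_contains_path => e f g eH fH gH ef fg; apply/set0Pn.
  have E1 := other e f eH fH ef; have E2 := other f g fH gH fg; rewrite E1 negbK in E2.
  case e1: (e \in F a b).
    rewrite e1 in E2; have [? _] := Fin _ _ _ e1; have [? _] := Fin _ _ _ E2.
    by exists a; rewrite inE; apply/andP.
  move: eH gH; rewrite !in_setU E2 e1 => /Fin[? _] /Fin[? _].
  by exists c; rewrite inE; apply/andP.
- apply: not_contains_triangle => e f g eH fH gH ef fg eg.
  have E1 := other e f eH fH ef; have E2 := other f g fH gH fg; have E3 := other e g eH gH eg.
  by move: E3; rewrite E2 E1; case: (e \in _).
- exists [set a; b; x], [set c; d; y]; split.
  + by rewrite in_setU Fmem //; neqs.
  + by rewrite in_setU orbC Fmem //; neqs.
  + apply/setP => t; rewrite !inE; apply/negP => /andP[/orP[/orP[]|]/eqP->]; neqs.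
- rewrite cardsU !Fcard // (_ : _ :&: _ = set0) ?cards0.
    by have := max_card (mem [set a; b]); rewrite cards2 ab; move: #|T|; clear; lia.
  apply/setP => e; rewrite !inE; apply/negP => /andP[e1 /Fin[ce de]].
  have [ae be] := Fin _ _ _ e1; have e3 := F3 _ _ _ ab e1.
  by have := card3_eq e3 (_ : uniq [:: a; b; c]) ae be ce => E; move: de; rewrite E; [rewrite !inE; neqs | neqs].
Qed.

(** [P] and [C] are connected, so a copy would lie inside one of the two five-point sets, which are
    too small for it. *)
Lemma two_cliques_family A : #|A| = 5 -> #|~: A| = 5 ->
  exists H, [/\ uniform H, ~ contains Ppath H, ~ contains Ctri H, matching H & #|H| = 20].
Proof.
move=> A5 B5.
pose F (B : {set T}) := [set e : {set T} | e \subset B & #|e| == 3].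
pose H := F A :|: F (~: A).
have F3 B e : e \in F B -> #|e| = 3 by rewrite inE => /andP[_ /eqP].
have FB B e : e \in F B -> e \subset B by rewrite inE => /andP[].
have uH : uniform H by move=> e; rewrite in_setU => /orP[]; apply: F3.
have same B e f : B = A \/ B = ~: A -> e \in F B -> f \in H -> #|e :&: f| = 1 -> f \in F B.
  move=> BA eB fH E; have : exists2 t, t \in e & t \in f.
    by have : 0 < #|e :&: f| by [rewrite E]; case/card_gt0P => t; rewrite inE => /andP[]; exists t.
  case=> t te tf; have tB := subsetP (FB _ _ eB) t te.
  case: BA => E'; rewrite E' in tB *; move: fH; rewrite in_setU => /orP[] fF //.
    by have := subsetP (FB _ _ fF) t tf; rewrite inE tB.
  by have := subsetP (FB _ _ fF) t tf; move: tB; rewrite inE => /negPf ->.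
have cap B e f : #|B| = 5 -> e \in F B -> f \in F B -> #|e :&: f| = 6 - #|e :|: f| /\ #|e :|: f| <= 5.
  move=> B5' eB fB; split.
    by have := cardsUI e f; rewrite (F3 _ _ eB) (F3 _ _ fB) => E; rewrite -[6]/(3 + 3) -E addKn.
  by rewrite -B5'; apply: subset_leq_card; rewrite subUset !FB.
have pick e : e \in H -> exists B, [/\ B = A \/ B = ~: A, #|B| = 5 & e \in F B].
  by rewrite in_setU => /orP[]; [exists A | exists (~: A)]; split=> //; [left | right].
exists H; split=> //.
- apply: not_contains_path => e f g eH fH gH ef fg; apply/negP => /eqP eg.
  have [B [BA B5' eB]] := pick e eH; have fB := same B e f BA eB fH ef.
  have gB := same B f g BA fB gH fg; have [] := cap B e g B5' eB gB.
  by rewrite eg cards0; case: #|_| => [|[|[|[|[|[|]]]]]].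
- apply: not_contains_triangle => e f g eH fH gH ef fg eg; apply/negP => /eqP efg.
  have [B [BA B5' eB]] := pick e eH; have fB := same B e f BA eB fH ef.
  have gB := same B f g BA fB gH fg.
  have : #|e :|: f :|: g| <= 5.
    by rewrite -B5'; apply: subset_leq_card; rewrite !subUset !FB.
  rewrite cardsU cardsU (F3 _ _ eB) (F3 _ _ fB) (F3 _ _ gB) ef setIUl.
  by rewrite cardsU eg fg -setIIl efg cards0.
- have ex B : #|B| = 5 -> exists2 e, e \in F B & e \subset B.
    move=> B5'; have : 0 < #|F B| by rewrite cards_draws B5'.
    by case/card_gt0P => e eB; exists e => //; apply: FB.
  have [e eA esA] := ex _ A5; have [f fA fsA] := ex _ B5.
  exists e, f; rewrite !in_setU eA fA orbT; split=> //; apply/setP => t; rewrite !inE.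
  by apply/negP => /andP[/(subsetP esA) tA /(subsetP fsA)]; rewrite inE tA.
rewrite cardsU !cards_draws A5 B5 (_ : _ :&: _ = set0) ?cards0 //.
apply/setP => e; rewrite in_setI in_set0; apply/negP => /andP[e1 e2].
have [t te] : exists t, t \in e by apply/set0Pn; rewrite -card_gt0 (F3 _ _ e1).
by have := subsetP (FB _ _ e2) t te; rewrite inE (subsetP (FB _ _ e1)).
Qed.

Definition comet (c : T) A := [set e : {set T} | (#|e| == 3) &&
  ((e \subset c |: A) || ((c \in e) && [disjoint e & A]))].

(** * The comet with arbitrary centre and triple *)

Section Comet.
Variables (c : T) (A : {set T}).
Hypotheses (cA : c \notin A) (A3 : #|A| = 3).

Lemma card_comet : #|comet c A| = 4 + 'C(#|T| - 4, 2).
Proof.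
pose R := ~: (c |: A).
have R4 : #|R| = #|T| - 4 by rewrite cardsCs setCK cardsU1 cA A3.
pose K := [set e : {set T} | e \subset c |: A & #|e| == 3].
pose D := (fun B : {set T} => c |: B) @: [set B : {set T} | B \subset R & #|B| == 2].
have notR B : B \subset R -> c \notin B.
  by move=> /subsetP BR; apply/negP => /BR; rewrite !inE eqxx.
have -> : comet c A = K :|: D.
  apply/setP => e; rewrite in_setU !inE andb_orr; congr (_ || _); first exact: andbC.
  apply/idP/imsetP => [/and3P[/eqP e3 ce d]|[B]].
    exists (e :\ c); last by rewrite setD1K.
    rewrite inE; apply/andP; split.
      apply/subsetP => t; rewrite !inE negb_or => /andP[-> te] /=.
      by move: d; rewrite disjoint_subset => /subsetP/(_ t te).
    by have := cardsD1 c e; rewrite ce e3; case: #|_| => [|[|[|]]].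
  rewrite inE => /andP[BR /eqP B2] ->; rewrite cardsU1 (notR _ BR) B2 !inE eqxx /=.
  rewrite disjoint_subset; apply/subsetP => t; rewrite in_setU1 inE => /orP[/eqP->//|tB].
  by have := subsetP BR t tB; rewrite !inE negb_or => /andP[].
rewrite cardsU (_ : K :&: D = set0) ?cards0 ?subn0; last first.
  apply/setP => e; rewrite in_setI in_set0; apply/negP => /andP[eK /imsetP[B]].
  rewrite inE => /andP[BR /eqP B2] eE; move: eK; rewrite inE eE subUset => /andP[/andP[_ BA] _].
  have [t tB] : exists t, t \in B by apply/set0Pn; rewrite -card_gt0 B2.
  by have := subsetP BR t tB; rewrite in_setC (subsetP BA).
rewrite cards_draws cardsU1 cA A3 card_in_imset ?cards_draws ?R4 //.
move=> B B'; rewrite !inE => /andP[/notR cB _] /andP[/notR cB' _] E.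
by rewrite -(setU1K cB) E setU1K.
Qed.

Lemma comet_uniform : uniform (comet c A).
Proof. by move=> e; rewrite inE => /andP[/eqP]. Qed.

(** [A] is the only edge missing [c], and it meets any other edge in no vertex or in two. Hence the
    edges of a copy of [P] or [C] would all contain [c]. *)
Lemma comet_meet e f : e \in comet c A -> f \in comet c A -> #|e :&: f| = 1 -> c \in e.
Proof.
rewrite !inE => /andP[/eqP e3 eC] /andP[/eqP f3 fC] E; apply/negPn/negP => ce.
rewrite (negPf ce) orbF in eC.
have eA : e = A.
  apply/eqP; rewrite eqEcard e3 A3 andbT; apply/subsetP => t te.
  by have := subsetP eC t te; rewrite in_setU1 => /orP[/eqP tc|//]; rewrite -tc te in ce.
case/orP: fC => [fc|/andP[_]]; last by rewrite -eA -setI_eq0 setIC => /eqP fe; rewrite fe cards0 in E.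
have : #|f :\: A| <= 1.
  rewrite -(cards1 c); apply: subset_leq_card; apply/subsetP => t; rewrite !inE => /andP[tA tf].
  by have := subsetP fc t tf; rewrite in_setU1 (negPf tA) orbF.
by have := cardsID A f; rewrite f3 setIC -eA E; case: #|_| => [|[|]].
Qed.

Lemma comet_no_path : ~ contains Ppath (comet c A).
Proof.
apply: not_contains_path => e f g eC fC gC ef fg; apply/set0Pn; exists c; rewrite inE.
by rewrite (comet_meet eC fC ef) (comet_meet gC fC) // setIC.
Qed.

Lemma comet_no_triangle : ~ contains Ctri (comet c A).
Proof.
apply: not_contains_triangle => e f g eC fC gC ef fg _; apply/set0Pn; exists c; rewrite !inE.
by rewrite (comet_meet eC fC ef) (comet_meet fC gC fg) (comet_meet gC fC) // setIC.
Qed.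

Lemma comet_matching : 6 <= #|T| -> matching (comet c A).
Proof.
move=> T6; have : 0 < #|[set B : {set T} | B \subset ~: (c |: A) & #|B| == 2]|.
  by rewrite cards_draws bin_gt0 cardsCs setCK cardsU1 cA A3 leq_subRL //; lia.
case/card_gt0P => B; rewrite inE => /andP[BR /eqP B2].
have outB t : t \in B -> t != c /\ t \notin A.
  by move/(subsetP BR); rewrite !inE negb_or => /andP[].
have cB : c \notin B by apply/negP => /outB[]; rewrite eqxx.
have d : [disjoint c |: B & A].
  by rewrite disjoint_subset; apply/subsetP => t; rewrite in_setU1 inE => /orP[/eqP->//|/outB[]].
exists A, (c |: B); split.
- by rewrite inE A3 eqxx subsetUr.
- by rewrite inE cardsU1 cB B2 d setU11 orbT.
- by apply/eqP; rewrite setIC setI_eq0.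
Qed.

End Comet.

Lemma comet_shapeP H c A : uniform H -> (forall e, e \in H -> e \subset c |: A \/ c \in e /\ [disjoint e & A]) ->
  H \subset comet c A.
Proof.
move=> u h; apply/subsetP => e eH; rewrite inE (u e eH) eqxx /=.
by case: (h e eH) => [->|[-> ->]] //; rewrite orbT.
Qed.

Lemma comet_hiso c c' A A' : c \notin A -> c' \notin A' -> #|A| = #|A'| -> hiso (comet c A) (comet c' A').
Proof.
move=> cA cA' AA'.
(* Each comet lists its centre, then its triple, then the remaining vertices; the isomorphism
   matches equal positions. *)
pose L x B := x :: enum (B : {set T}) ++ enum (~: (x |: B)).
have memL x B t : t \in L x B.
  by rewrite inE mem_cat !mem_enum !inE negb_or; case: eqP => //= _; case: (t \in B).
have sizeL x B : x \notin B -> size (L x B) = #|T|.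
  by move=> xB; rewrite /= size_cat -!cardE -addSn -add1n -[1]/(true : nat) -xB -cardsU1 cardsC.
have uL x B : x \notin B -> uniq (L x B).
  move=> xB; rewrite /= cat_uniq !enum_uniq mem_cat !mem_enum !inE eqxx (negPf xB) /= andbT.
  by apply/hasPn => t; rewrite !mem_enum !inE negb_or => /andP[].
pose f t := nth c (L c' A') (index t (L c A)).
have lt t : index t (L c A) < size (L c' A').
  by rewrite (sizeL c' A' cA') -(sizeL c A cA) index_mem.
have fi : injective f.
  move=> s t /eqP; rewrite nth_uniq ?uL ?lt // => /eqP E.
  by rewrite -(nth_index c (memL c A s)) E nth_index.
have fc : f c = c' by rewrite /f /= eqxx.
have fA : f @: A = A'.
  apply/eqP; rewrite eqEcard card_imset // AA' leqnn andbT; apply/subsetP => _ /imsetP[t tA ->].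
  have ct : c == t = false by apply: contraNF cA => /eqP->.
  rewrite /f /= ct /= index_cat mem_enum tA nth_cat.
  have lt' : index t (enum A) < size (enum A') by rewrite -cardE -AA' cardE index_mem mem_enum.
  by rewrite lt' -mem_enum mem_nth.
have fU : f @: (c |: A) = c' |: A' by rewrite imsetU1 fc fA.
have fb : bijective f := injF_bij fi.
exists f; split=> //; apply/setP => B.
have sub e (D : {set T}) : (f @: e \subset f @: D) = (e \subset D).
  apply/idP/idP => [/subsetP h|]; last exact: imsetS.
  by apply/subsetP => t te; have := h _ (imset_f f te); rewrite mem_imset.
have memC e : (f @: e \in comet c' A') = (e \in comet c A).
  by rewrite !inE card_imset // -fU sub -fc mem_imset // -fA imset_disjoint //; apply: in2W.
case: (fb) => g gf fg; have BE : f @: (g @: B) = B by rewrite -imset_comp (eq_imset _ fg) imset_id.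
apply/imsetP/idP => [[e eC ->]|BC]; first by rewrite memC.
by exists (g @: B); rewrite ?BE // -memC BE.
Qed.

Lemma hiso_sym (H1 H2 : {set {set T}}) : hiso H1 H2 -> hiso H2 H1.
Proof.
case=> f [[g gf fg] <-]; exists g; split; first by exists f.
rewrite -imset_comp -[RHS]imset_id; apply: eq_imset => e /=.
by rewrite -imset_comp (eq_imset _ gf) imset_id.
Qed.

Lemma hiso_trans_card (H1 H2 : {set {set T}}) : hiso H1 H2 -> #|H1| = #|H2|.
Proof.
by case=> f [fb <-]; rewrite card_imset //; apply: imset_inj; apply: bij_inj.
Qed.

Lemma hiso_contains (U : finType) (F : {set {set U}}) (H1 H2 : {set {set T}}) :
  hiso H1 H2 -> contains F H1 -> contains F H2.
Proof.
case=> f [fb <-] [g [gi gF]]; exists (f \o g); split; first exact: inj_comp (bij_inj fb) gi.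
by move=> e eF; rewrite imset_comp imset_f // gF.
Qed.

Lemma hiso_uniform (H1 H2 : {set {set T}}) : hiso H1 H2 -> uniform H1 -> uniform H2.
Proof.
case=> f [fb <-] u _ /imsetP[e eH ->]; rewrite card_imset ?u //; exact: bij_inj.
Qed.

End Avoidance.

(** * From the bounds to the conditional Turán numbers *)

Lemma admissibleP n (H : {set {set 'I_n}}) :
  uniform H -> ~ contains Ppath H -> ~ contains Ctri H -> matching H -> admissible H.
Proof. by move=> u nP nC m; split=> //; split=> //; split=> //; apply/contains_matching. Qed.

Lemma admissible_bounded n (H : {set {set 'I_n}}) : admissible H ->
  #|H| <= gbound n /\ (11 <= n -> #|H| = gbound n -> comet_shape H).
Proof.
case=> u [nP [nC cM]]; have pc := pcfree_of_forbidden u nP nC.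
have o : on H [set: 'I_n] by move=> e _; apply: subsetT.
have [_ _ h] := pcfree_bounds o pc.
have := h (iffLR (contains_matching u) cM).
by rewrite /comet_bounded cardsT card_ord.
Qed.

Lemma Comet_comet n (n4 : 3 < n) : exists (c : 'I_n) (A : {set 'I_n}),
  [/\ c \notin A, #|A| = 3 & Comet n = comet c A].
Proof.
case: n n4 => // n n4.
pose A : {set 'I_n.+1} := [set i : 'I_n.+1 | 0 < i < 4].
have cA : ord0 \notin A by rewrite inE.
exists ord0, A; split=> //.
  pose v k : 'I_n.+1 := inord k.
  have vE k : k < 4 -> v k = k :> nat by move=> k4; rewrite inordK // (leq_trans k4).
  have -> : A = [set v 1; v 2; v 3].
    apply/setP => i; rewrite !inE -!val_eqE /= !vE //.
    by case: i => [[|[|[|[|i]]]] ?].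
  by apply: card_set3; rewrite /= !inE -!val_eqE /= !vE.
apply/setP => e; rewrite !inE; congr (_ && (_ || _)).
  apply/forall_inP/subsetP => h i ie; have := h i ie; rewrite !inE -val_eqE /=; first by case: (val i).
  by case: (val i).
congr (_ && _).
  apply/exists_inP/idP => [[i ie /eqP i0]|ce]; last by exists ord0.
  by rewrite (_ : ord0 = i) //; apply: val_inj; rewrite i0.
rewrite disjoint_subset; apply/forall_inP/subsetP => h i ie; have := h i ie; rewrite !inE -?val_eqE /=.
  by case: (val i) => // m; rewrite -leqNgt.
by case: (val i) => // m; rewrite -leqNgt.
Qed.

Theorem mainTheorem6 :
  (forall n : nat, 6 <= n <= 9 -> ex_is n (2 * n - 4)) /\
  ex_is 10 20 /\
  (forall n : nat, 11 <= n ->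
     ex_is n (4 + 'C(n - 4, 2)) /\
     (forall H : {set {set 'I_n}},
        (admissible H /\ #|H| = 4 + 'C(n - 4, 2)) <-> hiso H (Comet n))).
Proof.
have upper n (H : {set {set 'I_n}}) : admissible H -> #|H| <= gbound n by case/admissible_bounded.
split; last split.
- move=> n /andP[n6 n9]; have G : gbound n = 2 * n - 4 by rewrite /gbound ltnS n9.
  split; last by move=> H; rewrite -G; apply: upper.
  have us : uniq [seq inord i : 'I_n.-1.+1 | i <- iota 0 6].
    rewrite map_inj_in_uniq ?iota_uniq // => i j; rewrite !mem_iota => /= i6 j6 /(congr1 val).
    by rewrite /= !inordK // prednK ?(leq_trans _ n6) // (leq_trans _ n6).
  case: n n6 {n9 G} us => // n _ /= us.
  have [H [u nP nC m c]] := two_pairs_family us.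
  by exists H; split; [apply: admissibleP | rewrite c card_ord].
- split; last by move=> H; apply: upper.
  pose A : {set 'I_10} := [set i : 'I_10 | i < 5].
  have A5 : #|A| = 5.
    by rewrite -sum1_card (eq_bigl (fun i : 'I_10 => i < 5)) ?big_mkcond ?big_ord_recr ?big_ord0 //= => i; rewrite inE.
  have B5 : #|~: A| = 5 by rewrite cardsCs setCK card_ord A5.
  have [H [u nP nC m c]] := two_cliques_family A5 B5.
  by exists H; split=> //; apply: admissibleP.
move=> n n11; have G : gbound n = 4 + 'C(n - 4, 2).
  rewrite /gbound; have -> : n < 10 = false by lia.
  by have -> : n == 10 = false by lia.
have [c [A [cA A3 CE]]] := Comet_comet (leq_trans (isT : 4 <= 11) n11).
have cardC : #|Comet n| = 4 + 'C(n - 4, 2) by rewrite CE card_comet // card_ord.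
have admC : admissible (Comet n).
  rewrite CE; apply: admissibleP.
  - exact: comet_uniform.
  - exact: comet_no_path.
  - exact: comet_no_triangle.
  - by apply: comet_matching; rewrite // card_ord (leq_trans _ n11).
split.
  by split; [exists (Comet n) | move=> H; rewrite -G; apply: upper].
move=> H; split=> [[aH cH]|iso].
  have [_ shape] := admissible_bounded aH.
  have [c' [A' [cA' A3' h]]] := shape n11 (etrans cH (esym G)).
  (* Containment in a comet with the same number of edges is equality. *)
  have HE : H = comet c' A'.
    apply/eqP; rewrite eqEcard (comet_shapeP (proj1 aH) h) /=.
    by rewrite cH card_comet // card_ord.
  by rewrite HE CE; apply: comet_hiso; rewrite // A3 A3'.
have iso' := hiso_sym iso; have [u [nP [nC m]]] := admC.
split; last by rewrite (hiso_trans_card iso).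
split; first exact: hiso_uniform iso' u.
split; first by move/(hiso_contains iso).
split; first by move/(hiso_contains iso).
exact: hiso_contains iso' m.
Qed.
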